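(* Let $(\mathcal{D},\mathrm{E},\mathbf{s},\mu,\lambda)$ be a simplicial descent category. Let $Ho\mathcal{D}=\mathcal{D}[\mathrm{E}^{-1}]$, and let $K\mathcal{D}$ be the category with the same objects as $\mathcal{D}$ and whose morphisms are the morphisms of $\mathcal{D}$ modulo homotopy. Then $Ho\mathcal{D}$ is isomorphic to the localized category of $K\mathcal{D}$ with respect to the class $\mathrm{E}$ modulo homotopy (the class of homotopy classes $[e]$ with $e\in\mathrm{E}$). In addition, the class $\mathrm{E}$ (modulo homotopy) admits a calculus of left fractions in $K\mathcal{D}$.
   Context: **Notation.** For a category $\mathcal{D}$, $\Delta^{\circ}\mathcal{D}$ and $\Delta^{\circ}\Delta^{\circ}\mathcal{D}$ are the categories of simplicial and bisimplicial objects in $\mathcal{D}$; $A\times\Delta$ is the constant simplicial object on $A\in\mathcal{D}$. For $X\in\Delta^{\circ}\mathcal{D}$, $\Delta\times X$ and $X\times\Delta$ are the bisimplicial objects $(\Delta\times X)_{n,m}=X_m$, $(X\times\Delta)_{n,m}=X_n$. $\mathrm{D}Z$ is the diagonal of $Z\in\Delta^{\circ}\Delta^{\circ}\mathcal{D}$. $\Upsilon:\Delta^{\circ}\mathcal{D}\to\Delta^{\circ}\mathcal{D}$ is the order-inverse functor: $(\Upsilon X)_n=X_n$, with the $i$-th face (resp. $j$-th degeneracy) in degree $n$ equal to the $(n-i)$-th face (resp. $(n-j)$-th degeneracy) of $X$. If $\mathcal{D}$ has finite coproducts and $K$ is a simplicial set with all $K_n$ finite, $(K\boxtimes X)_n=\coprod_{K_n}X_n$;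 $X\boxtimes K$ means $K\boxtimes X$, and for $A\in\mathcal{D}$, $K\boxtimes A=K\boxtimes(A\times\Delta)$. The maps $d^0,d^1:\Delta[0]\to\Delta[1]$ ($d^i$ omits the vertex $i$) and $s^0:\Delta[1]\to\Delta[0]$ induce $d^0,d^1:X\to X\boxtimes\Delta[1]$ and $s^0:X\boxtimes\Delta[1]\to X$. **Simplicial cylinder and cone.** For $f:X\to Y$, $g:X\to Z$ in $\Delta^{\circ}\mathcal{D}$, $Cyl(f,g)$ is the pushout of $f\sqcup g:X\sqcup X\to Y\sqcup Z$ along $d^0\sqcup d^1:X\sqcup X\to X\boxtimes\Delta[1]$; thus $Cyl(f,g)_n=Y_n\sqcup\coprod^n X_n\sqcup Z_n$. Canonical maps: $I_Y:Y\to Cyl(f,g)$, $J_Z:Z\to Cyl(f,g)$. The cone of $f$ is $C(f)=Cyl(f,X\to\ast)$, where $\ast$ is the final object. **Simplicial descent category.** Data $(\mathcal{D},\mathrm{E},\mathbf{s},\mu,\lambda)$ such that: (S1) $\mathcal{D}$ is a category with finite coproducts, initial object $0$ and final object $\ast$. (S2) $\mathrm{E}$ (the equivalences) is a saturated class of morphisms of $\mathcal{D}$ ($f\in\mathrm{E}$ iff $f$ becomes an isomorphism in $Ho\mathcal{D}=\mathcal{D}[\mathrm{E}^{-1}]$), with $\mathrm{E}\sqcup\mathrm{E}\subseteq\mathrm{E}$. An object $A$ is acyclic if $A\to\ast$ is in $\mathrm{E}$. (S3) $\mathbf{s}:\Delta^{\circ}\mathcal{D}\to\mathcal{D}$ is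 a functor (the simple functor) commuting with coproducts up to equivalence (the canonical maps $\mathbf{s}X\sqcup\mathbf{s}Y\to\mathbf{s}(X\sqcup Y)$ are in $\mathrm{E}$). (S4) $\mu:\mathbf{s}\mathrm{D}\to\mathbf{s}\mathbf{s}$ is an isomorphism of $Fun(\Delta^{\circ}\Delta^{\circ}\mathcal{D},\mathcal{D})[\mathrm{E}^{-1}]$ (functors localized at object-wise equivalences), where $\mathbf{s}\mathbf{s}Z=\mathbf{s}(n\mapsto\mathbf{s}(m\mapsto Z_{n,m}))$. (S5) $\lambda:\mathrm{R}:=\mathbf{s}(-\times\Delta)\to Id_{\mathcal{D}}$ is a natural transformation with $\lambda_X\in\mathrm{E}$ for all $X$, and there is a natural transformation $\rho:Id_{\mathcal{D}}\to\mathrm{R}$ with $\lambda\rho=Id$ (one such $\rho$ is fixed). (S6) If $f:X\to Y$ in $\Delta^{\circ}\mathcal{D}$ has all $f_n\in\mathrm{E}$, then $\mathbf{s}(f)\in\mathrm{E}$. (S7) A morphism $f$ of $\mathcal{D}$ is in $\mathrm{E}$ iff $\mathbf{s}C(f\times\Delta)$ is acyclic. (S8) $\mathbf{s}\Upsilon f\in\mathrm{E}$ if (and only if) $\mathbf{s}f\in\mathrm{E}$, for $f$ in $\Delta^{\circ}\mathcal{D}$. Compatibility: for $X\in\Delta^{\circ}\mathcal{D}$ the compositions $\mathbf{s}X\xrightarrow{\mu_{\Delta\times X}}\mathrm{R}\mathbf{s}X\xrightarrow{\lambda_{\mathbf{s}X}}\mathbf{s}X$ and $\mathbf{s}X\xrightarrow{\mu_{X\times\Delta}}\mathbf{s}(\mathrm{R}X)\xrightarrow{\mathbf{s}(\lambda_X)}\mathbf{s}X$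 are the identity in $Fun(\Delta^{\circ}\mathcal{D},\mathcal{D})[\mathrm{E}^{-1}]$. **Cylinders in $\mathcal{D}$.** For $C\xleftarrow{g}A\xrightarrow{f}B$ in $\mathcal{D}$, $cyl(f,g)=\mathbf{s}Cyl(f\times\Delta,g\times\Delta)$, with $i_B=\mathbf{s}(I_B)\rho_B:B\to cyl(f,g)$ and $j_C=\mathbf{s}(J_C)\rho_C:C\to cyl(f,g)$; $cyl$ is functorial in the diagram. Set $cyl(A)=\mathbf{s}(\Delta[1]\boxtimes A)=cyl(Id_A,Id_A)$ and $\sigma_A=\lambda_A\mathbf{s}(s^0):cyl(A)\to A$; $\sigma_Ai_A=\sigma_Aj_A=Id$. **Homotopy.** Consider triples $(i,j,\nu)$ with $i,j:A\to\widetilde{A}$, $\nu:\widetilde{A}\to A$, $\nu i=\nu j=Id_A$. Gluing $(i,j,\nu)$ on $\widetilde{A}$ and $(p,q,\varrho)$ on $\widehat{A}$ gives $(s,t,\eta)$ on $\overline{A}=cyl(p,j)$: with canonical maps $\alpha:\widetilde{A}\to\overline{A}$, $\beta:\widehat{A}\to\overline{A}$, put $s=\alpha i$, $t=\beta q$, $\eta=\sigma_A\circ cyl(\varrho,Id_A,\nu)$, where $cyl(\varrho,Id_A,\nu):cyl(p,j)\to cyl(A)$ is the map induced by $\varrho,Id_A,\nu$. The admissible cylinders of $A$ are defined inductively: (I) $(Id_A,Id_A,Id_A)$ is one; (II) if $(i,j,\sigma)$ is one, so is $(j,i,\sigma)$; (III) the gluing of two admissible cylinders is one. Maps $f,g:A\to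 B$ are homotopic if there are an admissible cylinder $(i,j,\sigma)$ on $\widetilde{A}$ and $H:\widetilde{A}\to B$ with $Hi=f$, $Hj=g$. This is an equivalence relation compatible with composition on both sides. *)

(* Defs.v *)
Set Warnings "-notation-overridden".
From Stdlib Require Import Setoid Morphisms.
From mathcomp Require Import all_boot.

Set Implicit Arguments.
Unset Strict Implicit.
Unset Printing Implicit Defensive.
Set Primitive Projections.

Declare Scope cat_scope.
Delimit Scope cat_scope with cat.
Local Open Scope cat_scope.

(** Hom-sets are setoids: [heq] plays the role of equality of morphisms (an
    ordinary category is the case where [heq] is [eq]).  In this way a category
    whose morphisms are classes (a localization, a quotient by a congruence)
    has representatives as morphisms and the equivalence relation as [heq].
    Equality of objects is the equality of Rocq. *)

Record Category := MkCategory {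
  ob :> Type;
  hom : ob -> ob -> Type;
  heq : forall x y, hom x y -> hom x y -> Prop;
  idm : forall x, hom x x;
  comp : forall x y z, hom y z -> hom x y -> hom x z;
  heq_equiv : forall x y, Equivalence (@heq x y);
  comp_heq : forall x y z (g g' : hom y z) (f f' : hom x y),
    heq g g' -> heq f f' -> heq (comp g f) (comp g' f');
  compA : forall w x y z (h : hom y z) (g : hom x y) (f : hom w x),
    heq (comp h (comp g f)) (comp (comp h g) f);
  comp1m : forall x y (f : hom x y), heq (comp (idm y) f) f;
  compm1 : forall x y (f : hom x y), heq (comp f (idm x)) f
}.

Arguments hom {c} _ _.
Arguments heq {c x y} _ _.
Arguments idm {c} _.
Arguments comp {c x y z} _ _.

Notation "f ≈ g" := (heq f g) (at level 70, no associativity) : cat_scope.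
Notation "g ∘ f" := (comp g f) (at level 40, left associativity) : cat_scope.

#[export] Instance heq_Equivalence (C : Category) (x y : C) :
  Equivalence (@heq C x y) := @heq_equiv C x y.

#[export] Hint Extern 0 (heq _ _) => reflexivity : core.

#[export] Instance comp_Proper (C : Category) (x y z : C) :
  Proper (@heq C y z ==> @heq C x y ==> @heq C x z) (@comp C x y z).
Proof. by move=> g g' eg f f' ef; apply: comp_heq. Qed.

Definition is_iso (C : Category) (x y : C) (f : hom x y) : Prop :=
  exists g : hom y x, g ∘ f ≈ idm x /\ f ∘ g ≈ idm y.

Definition op (C : Category) : Category.
Proof.
refine (@MkCategory C (fun x y => @hom C y x) (fun x y => @heq C y x)
  (@idm C) (fun x y z g f => @comp C z y x f g) _ _ _ _ _).
- by move=> x y z g g' f f' eg ef; apply: comp_heq.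
- by move=> w x y z h g f; symmetry; apply: compA.
- by move=> x y f; apply: compm1.
- by move=> x y f; apply: comp1m.
Defined.

Record Functor (C D : Category) := MkFunctor {
  fob :> C -> D;
  fmap : forall x y, hom x y -> hom (fob x) (fob y);
  fmap_heq : forall x y (f g : hom x y), f ≈ g -> fmap f ≈ fmap g;
  fmap1 : forall x, fmap (idm x) ≈ idm (fob x);
  fmapM : forall x y z (g : hom y z) (f : hom x y),
    fmap (g ∘ f) ≈ fmap g ∘ fmap f
}.

Arguments fmap {C D} _ {x y} _.

#[export] Instance fmap_Proper (C D : Category) (F : Functor C D) (x y : C) :
  Proper (@heq C x y ==> @heq D (F x) (F y)) (@fmap C D F x y).
Proof. by move=> f g; apply: fmap_heq. Qed.

Record NatTrans (C D : Category) (F G : Functor C D) := MkNatTrans {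
  ntc :> forall x : C, hom (F x) (G x);
  nt_nat : forall (x y : C) (f : hom x y), ntc y ∘ fmap F f ≈ fmap G f ∘ ntc x
}.

Definition idF (C : Category) : Functor C C.
Proof. by refine (@MkFunctor C C (fun x => x) (fun x y f => f) _ _ _) => //. Defined.

Definition compF (A B C : Category) (G : Functor B C) (F : Functor A B) :
  Functor A C.
Proof.
refine (@MkFunctor A C (fun x => G (F x)) (fun x y f => fmap G (fmap F f)) _ _ _).
- by move=> x y f g e; rewrite e.
- by move=> x; rewrite !fmap1.
- by move=> x y z g f; rewrite !fmapM.
Defined.

Notation "G ∘F F" := (compF G F) (at level 40, left associativity) : cat_scope.

Definition opF (A B : Category) (F : Functor A B) : Functor (op A) (op B).
Proof.
refine (@MkFunctor (op A) (op B) F (fun x y f => fmap F f) _ _ _).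
- by move=> x y f g e; exact: (@fmap_heq A B F y x f g e).
- by move=> x; exact: (@fmap1 A B F x).
- by move=> x y z g f; exact: (@fmapM A B F z y x f g).
Defined.

(** Strict equality of functors, the morphisms being compared after transport
    along the equalities of objects. *)
Definition eq_hom (C : Category) (x y : C) (e : x = y) : hom x y :=
  match e in _ = z return hom x z with erefl => idm x end.

Definition eqF (C D : Category) (F G : Functor C D) : Prop :=
  exists e : forall x, F x = G x,
  forall (x y : C) (f : hom x y),
    eq_hom (e y) ∘ fmap F f ≈ fmap G f ∘ eq_hom (e x).

Definition is_cat_iso (C D : Category) (F : Functor C D) : Prop :=
  exists G : Functor D C, eqF (G ∘F F) (idF C) /\ eqF (F ∘F G) (idF D).

Lemma fmap_chain (C D : Category) (F : Functor C D) (w x y z : C) (a b : D)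
  (l : hom (F z) b) (h : hom y z) (g : hom x y) (f : hom w x) (r : hom a (F w)) :
  l ∘ fmap F h ∘ fmap F g ∘ (fmap F f ∘ r) ≈ l ∘ (fmap F (h ∘ (g ∘ f)) ∘ r).
Proof. by rewrite !fmapM !compA. Qed.

Definition idN (C D : Category) (F : Functor C D) : NatTrans F F.
Proof.
refine (@MkNatTrans C D F F (fun x => idm (F x)) _).
by move=> x y f; rewrite comp1m compm1.
Defined.

Definition compN (C D : Category) (F G H : Functor C D)
  (b : NatTrans G H) (a : NatTrans F G) : NatTrans F H.
Proof.
refine (@MkNatTrans C D F H (fun x => b x ∘ a x) _).
by move=> x y f; rewrite -compA nt_nat compA nt_nat compA.
Defined.

Definition Fun (C D : Category) : Category.
Proof.
refine (@MkCategory (Functor C D) (@NatTrans C D)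
  (fun F G a b => forall x, a x ≈ b x) (@idN C D) (@compN C D) _ _ _ _ _).
- move=> F G; split.
  + by move=> a x.
  + by move=> a b e x; symmetry.
  + by move=> a b c e1 e2 x; transitivity (b x).
- by move=> F G H b b' a a' eb ea x /=; rewrite eb ea.
- by move=> F G H K c b a x /=; rewrite compA.
- by move=> F G a x /=; rewrite comp1m.
- by move=> F G a x /=; rewrite compm1.
Defined.

Definition constF (J C : Category) (A : C) : Functor J C.
Proof.
refine (@MkFunctor J C (fun _ => A) (fun x y _ => idm A) _ _ _) => //.
by move=> x y z g f /=; rewrite comp1m.
Defined.

Definition constN (J C : Category) (A B : C) (f : hom A B) :
  NatTrans (constF J A) (constF J B).
Proof.
refine (@MkNatTrans J C (constF J A) (constF J B) (fun _ => f) _).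
by move=> x y h /=; rewrite comp1m compm1.
Defined.

Definition Const (J C : Category) : Functor C (Fun J C).
Proof.
refine (@MkFunctor C (Fun J C) (@constF J C) (@constN J C) _ _ _).
- by move=> A B f g e x; exact: e.
- by move=> A x /=.
- by move=> A B D g f x /=.
Defined.

Definition whiskL (J C D : Category) (F : Functor C D) (X Y : Functor J C)
  (a : NatTrans X Y) : NatTrans (F ∘F X) (F ∘F Y).
Proof.
refine (@MkNatTrans J D (F ∘F X) (F ∘F Y) (fun x => fmap F (a x)) _).
by move=> x y f /=; rewrite -!fmapM nt_nat.
Defined.

Definition whiskR (I J C : Category) (X Y : Functor J C) (a : NatTrans X Y)
  (G : Functor I J) : NatTrans (X ∘F G) (Y ∘F G).
Proof.
refine (@MkNatTrans I C (X ∘F G) (Y ∘F G) (fun x => a (G x)) _).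
by move=> x y f /=; rewrite nt_nat.
Defined.

Definition Post (J C D : Category) (F : Functor C D) :
  Functor (Fun J C) (Fun J D).
Proof.
refine (@MkFunctor (Fun J C) (Fun J D) (fun X => F ∘F X)
  (fun X Y a => whiskL F a) _ _ _).
- by move=> X Y a b e x /=; rewrite (e x).
- by move=> X x /=; rewrite fmap1.
- by move=> X Y Z b a x /=; rewrite fmapM.
Defined.

Definition Pre (I J C : Category) (G : Functor I J) :
  Functor (Fun J C) (Fun I C).
Proof.
refine (@MkFunctor (Fun J C) (Fun I C) (fun X => X ∘F G)
  (fun X Y a => whiskR a G) _ _ _).
- by move=> X Y a b e x /=; apply: e.
- by move=> X x /=.
- by move=> X Y Z b a x /=.
Defined.

(** [Loc C E] is the localization of [C] at the class [E]: its morphisms are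
    represented by the formal composites of morphisms of [C] and of formal
    inverses of members of [E], and [zeq] is the least congruence making
    [C -> Loc C E] a functor and the formal inverses inverses. *)

Definition MorClass (C : Category) : Type := forall x y : C, hom x y -> Prop.

Section Localization.
Context (C : Category) (E : MorClass C).

Inductive zig : C -> C -> Type :=
| zfwd x y (f : hom x y) : zig x y
| zinv x y (f : hom x y) (Ef : E f) : zig y x
| zcomp x y z (q : zig y z) (p : zig x y) : zig x z.

Inductive zeq : forall x y, zig x y -> zig x y -> Prop :=
| zeq_refl x y (p : zig x y) : zeq p p
| zeq_sym x y (p q : zig x y) : zeq p q -> zeq q p
| zeq_trans x y (p q r : zig x y) : zeq p q -> zeq q r -> zeq p r
| zeq_cong x y z (q q' : zig y z) (p p' : zig x y) :
    zeq q q' -> zeq p p' -> zeq (zcomp q p) (zcomp q' p')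
| zeq_assoc w x y z (r : zig y z) (q : zig x y) (p : zig w x) :
    zeq (zcomp r (zcomp q p)) (zcomp (zcomp r q) p)
| zeq_1z x y (p : zig x y) : zeq (zcomp (zfwd (idm y)) p) p
| zeq_z1 x y (p : zig x y) : zeq (zcomp p (zfwd (idm x))) p
| zeq_fwd x y (f g : hom x y) : f ≈ g -> zeq (zfwd f) (zfwd g)
| zeq_comp x y z (g : hom y z) (f : hom x y) :
    zeq (zfwd (g ∘ f)) (zcomp (zfwd g) (zfwd f))
| zeq_invl x y (f : hom x y) (Ef : E f) :
    zeq (zcomp (zinv Ef) (zfwd f)) (zfwd (idm x))
| zeq_invr x y (f : hom x y) (Ef : E f) :
    zeq (zcomp (zfwd f) (zinv Ef)) (zfwd (idm y)).

Definition Loc : Category.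
Proof.
refine (@MkCategory C zig zeq (fun x => zfwd (idm x)) zcomp _ _ _ _ _).
- move=> x y; split.
  + by move=> p; apply: zeq_refl.
  + by move=> p q; apply: zeq_sym.
  + by move=> p q r; apply: zeq_trans.
- by move=> x y z q q' p p'; apply: zeq_cong.
- by move=> w x y z r q p; apply: zeq_assoc.
- by move=> x y p; apply: zeq_1z.
- by move=> x y p; apply: zeq_z1.
Defined.

Definition toLoc : Functor C Loc.
Proof.
refine (@MkFunctor C Loc (fun x => x) (fun x y f => zfwd f) _ _ _).
- by move=> x y f g; apply: zeq_fwd.
- by move=> x; apply: zeq_refl.
- by move=> x y z g f; apply: zeq_comp.
Defined.

End Localization.

Section LocalizationMap.
Context (C C' : Category) (E : MorClass C) (E' : MorClass C').
Context (F : Functor C C').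
Context (FE : forall x y (f : hom x y), E f -> E' (fmap F f)).

Fixpoint zmap x y (p : zig E x y) : zig E' (F x) (F y) :=
  match p with
  | zfwd _ _ f => zfwd E' (fmap F f)
  | zinv _ _ _ Ef => zinv (FE Ef)
  | zcomp _ _ _ q p => zcomp (zmap q) (zmap p)
  end.

Definition LocMap : Functor (Loc E) (Loc E').
Proof.
refine (@MkFunctor (Loc E) (Loc E') F zmap _ _ _).
- move=> x y p q; elim {x y p q} => /=.
  + by move=> *; apply: zeq_refl.
  + by move=> *; apply: zeq_sym.
  + by move=> x y p q r _ e1 _; apply: zeq_trans e1.
  + by move=> *; apply: zeq_cong.
  + by move=> *; apply: zeq_assoc.
  + move=> x y p; apply: zeq_trans (zeq_1z _).
    apply: zeq_cong (zeq_refl _).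
    by apply: zeq_fwd; apply: fmap1.
  + move=> x y p; apply: zeq_trans (zeq_z1 _).
    apply: zeq_cong; first exact: zeq_refl.
    by apply: zeq_fwd; apply: fmap1.
  + by move=> x y f g e; apply: zeq_fwd; apply: fmap_heq.
  + move=> x y z g f; apply: zeq_trans (zeq_comp _ _ _).
    by apply: zeq_fwd; apply: fmapM.
  + move=> x y f Ef; apply: zeq_trans (zeq_invl _) _.
    by apply: zeq_fwd; symmetry; apply: fmap1.
  + move=> x y f Ef; apply: zeq_trans (zeq_invr _) _.
    by apply: zeq_fwd; symmetry; apply: fmap1.
- by move=> x; apply: zeq_fwd; apply: fmap1.
- by move=> x y z g f; apply: zeq_refl.
Defined.

End LocalizationMap.

Definition objwise (J C : Category) (E : MorClass C) : MorClass (Fun J C) :=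
  fun F G (a : hom F G) => forall x, E _ _ (ntc a x).

Definition LocPre (I J C : Category) (E : MorClass C) (G : Functor I J) :
  Functor (Loc (@objwise J C E)) (Loc (@objwise I C E)) :=
  @LocMap _ _ (@objwise J C E) (@objwise I C E) (@Pre I J C G)
    (fun F F' a Ea x => Ea (G x)).

Definition left_fractions (C : Category) (S : MorClass C) : Prop :=
  [/\ forall x : C, S _ _ (idm x),
      forall (x y z : C) (g : hom y z) (f : hom x y),
        S _ _ f -> S _ _ g -> S _ _ (g ∘ f),
      forall (x x' y : C) (s : hom x x') (u : hom x y), S _ _ s ->
        exists (y' : C) (t : hom y y') (u' : hom x' y'),
          S _ _ t /\ u' ∘ s ≈ t ∘ u
    & forall (x' x y : C) (s : hom x' x) (f g : hom x y), S _ _ s ->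
        f ∘ s ≈ g ∘ s ->
        exists (y' : C) (t : hom y y'), S _ _ t /\ t ∘ f ≈ t ∘ g].

Record Coproduct (C : Category) (I : finType) (F : I -> C) := MkCoproduct {
  cop_ob : C;
  cop_in : forall i, hom (F i) cop_ob;
  cop_desc : forall T : C, (forall i, hom (F i) T) -> hom cop_ob T;
  cop_descE : forall (T : C) (h : forall i, hom (F i) T) i,
    cop_desc h ∘ cop_in i ≈ h i;
  cop_uniq : forall (T : C) (u v : hom cop_ob T),
    (forall i, u ∘ cop_in i ≈ v ∘ cop_in i) -> u ≈ v
}.
Arguments cop_in {C I F} c i.
Arguments cop_desc {C I F} c {T} h.

(** A choice of a coproduct for every finite family; the empty family gives the
    initial object. *)
Definition FinCoproducts (C : Category) : Type :=
  forall (I : finType) (F : I -> C), Coproduct F.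

Record Terminal (C : Category) := MkTerminal {
  ter_ob : C;
  ter_map : forall x : C, hom x ter_ob;
  ter_uniq : forall (x : C) (f g : hom x ter_ob), f ≈ g
}.
Arguments ter_map {C} t x.

Record Pushout (C : Category) (A B B' : C) (f : hom A B) (f' : hom A B') :=
MkPushout {
  po_ob : C;
  po_inl : hom B po_ob;
  po_inr : hom B' po_ob;
  po_comm : po_inl ∘ f ≈ po_inr ∘ f';
  po_desc : forall (T : C) (h : hom B T) (h' : hom B' T),
    h ∘ f ≈ h' ∘ f' -> hom po_ob T;
  po_descl : forall T h h' e, @po_desc T h h' e ∘ po_inl ≈ h;
  po_descr : forall T h h' e, @po_desc T h h' e ∘ po_inr ≈ h';
  po_uniq : forall (T : C) (u v : hom po_ob T),
    u ∘ po_inl ≈ v ∘ po_inl -> u ∘ po_inr ≈ v ∘ po_inr -> u ≈ v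
}.
Arguments po_inl {C A B B' f f'} p.
Arguments po_inr {C A B B' f f'} p.
Arguments po_desc {C A B B' f f'} p {T h h'} e.

Record BinCoproduct (C : Category) (A B : C) := MkBinCoproduct {
  bc_ob : C;
  in1 : hom A bc_ob;
  in2 : hom B bc_ob;
  copair : forall T : C, hom A T -> hom B T -> hom bc_ob T;
  copair1 : forall T (f : hom A T) (g : hom B T), copair f g ∘ in1 ≈ f;
  copair2 : forall T (f : hom A T) (g : hom B T), copair f g ∘ in2 ≈ g;
  bc_uniq : forall (T : C) (u v : hom bc_ob T),
    u ∘ in1 ≈ v ∘ in1 -> u ∘ in2 ≈ v ∘ in2 -> u ≈ v
}.
Arguments in1 {C A B} b.
Arguments in2 {C A B} b.
Arguments copair {C A B} b {T} f g.

Definition bc_map (C : Category) (A B A' B' : C) (S : BinCoproduct A B)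
  (S' : BinCoproduct A' B') (f : hom A A') (g : hom B B') :
  hom (bc_ob S) (bc_ob S') := copair S (in1 S' ∘ f) (in2 S' ∘ g).

Definition bfam (C : Category) (A B : C) : bool -> C :=
  fun b => if b then A else B.

Definition bcop (C : Category) (cop : FinCoproducts C) (A B : C) :
  BinCoproduct A B.
Proof.
pose S := @cop bool (bfam A B).
pose h T (f : hom A T) (g : hom B T) (b : bool) : hom (bfam A B b) T :=
  match b with true => f | false => g end.
refine (@MkBinCoproduct C A B (cop_ob S) (cop_in S true) (cop_in S false)
  (fun T f g => cop_desc S (h T f g)) _ _ _).
- by move=> T f g; exact: (cop_descE S (h T f g) true).
- by move=> T f g; exact: (cop_descE S (h T f g) false).
- by move=> T u v e1 e2; apply: cop_uniq => -[].
Defined.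

Section FunCoproducts.
Context (J C : Category) (cop : FinCoproducts C).
Context (I : finType) (F : I -> Functor J C).

Let P (x : J) := @cop I (fun i => F i x).

Definition fcop_ob : Functor J C.
Proof.
refine (@MkFunctor J C (fun x => cop_ob (P x))
  (fun x y f => cop_desc (P x) (fun i => cop_in (P y) i ∘ fmap (F i) f)) _ _ _).
- by move=> x y f g e; apply: cop_uniq => i; rewrite !cop_descE e.
- by move=> x; apply: cop_uniq => i; rewrite cop_descE fmap1 comp1m compm1.
- move=> x y z g f; apply: cop_uniq => i.
  by rewrite cop_descE -compA cop_descE compA cop_descE fmapM compA.
Defined.

Definition fcop_in (i : I) : NatTrans (F i) fcop_ob.
Proof.
refine (@MkNatTrans J C (F i) fcop_ob (fun x => cop_in (P x) i) _).
by move=> x y f /=; rewrite cop_descE.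
Defined.

Definition fcop_desc (T : Functor J C) (h : forall i, NatTrans (F i) T) :
  NatTrans fcop_ob T.
Proof.
refine (@MkNatTrans J C fcop_ob T (fun x => cop_desc (P x) (fun i => h i x)) _).
move=> x y f; apply: cop_uniq => i.
by rewrite -!compA /= !cop_descE compA cop_descE nt_nat.
Defined.

Definition fcop : @Coproduct (Fun J C) I F.
Proof.
refine (@MkCoproduct (Fun J C) I F fcop_ob fcop_in fcop_desc _ _).
- by move=> T h i x /=; rewrite cop_descE.
- by move=> T u v e x; apply: cop_uniq => i; apply: (e i x).
Defined.

End FunCoproducts.

Definition Fun_coproducts (J C : Category) (cop : FinCoproducts C) :
  FinCoproducts (Fun J C) := @fcop J C cop.

Definition fter_map (J C : Category) (t : Terminal C) (X : Functor J C) :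
  NatTrans X (constF J (ter_ob t)).
Proof.
refine (@MkNatTrans J C X (constF J (ter_ob t)) (fun x => ter_map t (X x)) _).
by move=> x y f; apply: ter_uniq.
Defined.

Definition Fun_terminal (J C : Category) (t : Terminal C) : Terminal (Fun J C).
Proof.
refine (@MkTerminal (Fun J C) (constF J (ter_ob t)) (@fter_map J C t) _).
by move=> X a b x; apply: ter_uniq.
Defined.

Section FunPushout.
Context (J C : Category) (A B B' : Functor J C).
Context (f : NatTrans A B) (f' : NatTrans A B').
Context (P : forall x, Pushout (f x) (f' x)).

Lemma fpo_comm x y (h : hom x y) :
  (po_inl (P y) ∘ fmap B h) ∘ f x ≈ (po_inr (P y) ∘ fmap B' h) ∘ f' x.
Proof. by rewrite -!compA -!nt_nat !compA po_comm. Qed.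

Definition fpo_ob : Functor J C.
Proof.
refine (@MkFunctor J C (fun x => po_ob (P x))
  (fun x y h => po_desc (P x) (fpo_comm h)) _ _ _).
- by move=> x y h k e; apply: po_uniq; rewrite ?po_descl ?po_descr e.
- by move=> x; apply: po_uniq; rewrite ?po_descl ?po_descr fmap1 compm1 comp1m.
- move=> x y z k h; apply: po_uniq.
    by rewrite po_descl -compA po_descl compA po_descl fmapM compA.
  by rewrite po_descr -compA po_descr compA po_descr fmapM compA.
Defined.

Definition fpo_inl : NatTrans B fpo_ob.
Proof.
refine (@MkNatTrans J C B fpo_ob (fun x => po_inl (P x)) _).
by move=> x y h /=; rewrite po_descl.
Defined.

Definition fpo_inr : NatTrans B' fpo_ob.
Proof.
refine (@MkNatTrans J C B' fpo_ob (fun x => po_inr (P x)) _).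
by move=> x y h /=; rewrite po_descr.
Defined.

Definition fpo_desc (T : Functor J C) (h : NatTrans B T) (h' : NatTrans B' T)
  (e : forall x, h x ∘ f x ≈ h' x ∘ f' x) : NatTrans fpo_ob T.
Proof.
refine (@MkNatTrans J C fpo_ob T (fun x => po_desc (P x) (e x)) _).
move=> x y k; apply: po_uniq => /=.
  by rewrite -!compA !po_descl compA po_descl nt_nat.
by rewrite -!compA !po_descr compA po_descr nt_nat.
Defined.

Definition Fun_pushout : @Pushout (Fun J C) A B B' f f'.
Proof.
refine (@MkPushout (Fun J C) A B B' f f' fpo_ob fpo_inl fpo_inr _ fpo_desc _ _ _).
- by move=> x; apply: po_comm.
- by move=> T h h' e x /=; apply: po_descl.
- by move=> T h h' e x /=; apply: po_descr.
- by move=> T u v e1 e2 x; apply: po_uniq; [apply: e1|apply: e2].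
Defined.

End FunPushout.

(** Double mapping cylinders in a category: pushouts of [f ⊔ g : X ⊔ X -> Y ⊔ Z]
    along a map [(d, e) : X ⊔ X -> W]. *)
Section DoubleCylinder.
Context (C : Category).
Context (X Y Z W : C) (XX : BinCoproduct X X) (YZ : BinCoproduct Y Z).
Context (d e : hom X W) (f : hom X Y) (g : hom X Z).
Context (P : Pushout (copair XX d e) (bc_map XX YZ f g)).

Lemma dcyl_eq (T : C) (h : hom W T) (l : hom (bc_ob YZ) T) :
  h ∘ d ≈ l ∘ in1 YZ ∘ f -> h ∘ e ≈ l ∘ in2 YZ ∘ g ->
  h ∘ copair XX d e ≈ l ∘ bc_map XX YZ f g.
Proof.
by move=> e1 e2; apply: bc_uniq; rewrite -!compA /bc_map ?copair1 ?copair2 compA.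
Qed.

Lemma dcyl1 : po_inl P ∘ d ≈ po_inr P ∘ in1 YZ ∘ f.
Proof.
have := comp_heq (po_comm P) (reflexivity (in1 XX)).
by rewrite -!compA /bc_map !copair1 => ->.
Qed.

Lemma dcyl2 : po_inl P ∘ e ≈ po_inr P ∘ in2 YZ ∘ g.
Proof.
have := comp_heq (po_comm P) (reflexivity (in2 XX)).
by rewrite -!compA /bc_map !copair2 => ->.
Qed.

End DoubleCylinder.

Section DoubleCylinderMap.
Context (C : Category).
Context (X Y Z W : C) (XX : BinCoproduct X X) (YZ : BinCoproduct Y Z).
Context (d e : hom X W) (f : hom X Y) (g : hom X Z).
Context (P : Pushout (copair XX d e) (bc_map XX YZ f g)).
Context (X' Y' Z' W' : C) (XX' : BinCoproduct X' X') (YZ' : BinCoproduct Y' Z').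
Context (d' e' : hom X' W') (f' : hom X' Y') (g' : hom X' Z').
Context (P' : Pushout (copair XX' d' e') (bc_map XX' YZ' f' g')).
Context (y : hom Y Y') (x : hom X X') (z : hom Z Z') (w : hom W W').
Context (wd : w ∘ d ≈ d' ∘ x) (we : w ∘ e ≈ e' ∘ x).
Context (yf : y ∘ f ≈ f' ∘ x) (zg : z ∘ g ≈ g' ∘ x).

Lemma dcyl_map_square :
  (po_inl P' ∘ w) ∘ copair XX d e ≈
  (po_inr P' ∘ bc_map YZ YZ' y z) ∘ bc_map XX YZ f g.
Proof.
apply: dcyl_eq; rewrite -!compA.
  by rewrite wd compA dcyl1 /bc_map (compA _ _ f) copair1 -!compA yf.
by rewrite we compA dcyl2 /bc_map (compA _ _ g) copair2 -!compA zg.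
Qed.

Definition dcyl_map : hom (po_ob P) (po_ob P') := po_desc P dcyl_map_square.

Lemma dcyl_map1 : dcyl_map ∘ (po_inr P ∘ in1 YZ) ≈ (po_inr P' ∘ in1 YZ') ∘ y.
Proof. by rewrite compA po_descr -!compA /bc_map copair1. Qed.

Lemma dcyl_map2 : dcyl_map ∘ (po_inr P ∘ in2 YZ) ≈ (po_inr P' ∘ in2 YZ') ∘ z.
Proof. by rewrite compA po_descr -!compA /bc_map copair2. Qed.

End DoubleCylinderMap.

Section DoubleCylinderFold.
Context (C : Category).
Context (X W : C) (XX YZ : BinCoproduct X X).
Context (d e : hom X W) (f : hom X X) (g : hom X X).
Context (P : Pushout (copair XX d e) (bc_map XX YZ f g)).
Context (ef : f ≈ idm X) (eg : g ≈ idm X).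

Lemma dcyl_fold_square :
  idm W ∘ copair XX d e ≈ copair YZ d e ∘ bc_map XX YZ f g.
Proof.
apply: dcyl_eq; rewrite comp1m.
  by rewrite copair1 ef compm1.
by rewrite copair2 eg compm1.
Qed.

Definition dcyl_fold : hom (po_ob P) W := po_desc P dcyl_fold_square.

Lemma dcyl_fold1 : dcyl_fold ∘ (po_inr P ∘ in1 YZ) ≈ d.
Proof. by rewrite compA po_descr copair1. Qed.

Lemma dcyl_fold2 : dcyl_fold ∘ (po_inr P ∘ in2 YZ) ≈ e.
Proof. by rewrite compA po_descr copair2. Qed.

End DoubleCylinderFold.

Section TwoPoints.
Context (C : Category) (cop : FinCoproducts C).
Context (K : finType) (a b : K) (ab : a != b).
Context (A Y Z : C) (f : hom A Y) (g : hom A Z).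

Let KA := @cop K (fun=> A).
Let M : finType := {k : K | (k != a) && (k != b)}.
Let MA := @cop M (fun=> A).

(** For [u : A ⊔ A -> ∐_K A] the inclusion of the summands indexed by [a] and
    [b], the pushout of [f ⊔ g : A ⊔ A -> Y ⊔ Z] along [u] is
    [Y ⊔ (∐_{k ≠ a, b} A) ⊔ Z]. *)
Context (AA : BinCoproduct A A) (YZ : BinCoproduct Y Z).
Context (u : hom (bc_ob AA) (cop_ob KA)).
Context (ua : u ∘ in1 AA ≈ cop_in KA a) (ub : u ∘ in2 AA ≈ cop_in KA b).
Context (v : hom (bc_ob AA) (bc_ob YZ)).
Context (vf : v ∘ in1 AA ≈ in1 YZ ∘ f) (vg : v ∘ in2 AA ≈ in2 YZ ∘ g).

Let YM := bcop cop Y (cop_ob MA).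
Let YMZ := bcop cop (bc_ob YM) Z.

Definition tp_ob : C := bc_ob YMZ.
Definition tp_Y : hom Y tp_ob := in1 YMZ ∘ in1 YM.
Definition tp_M : hom (cop_ob MA) tp_ob := in1 YMZ ∘ in2 YM.
Definition tp_Z : hom Z tp_ob := in2 YMZ.

Definition tp_comp (k : K) : hom A tp_ob :=
  match insub k : option M with
  | Some m => tp_M ∘ cop_in MA m
  | None => if k == a then tp_Y ∘ f else tp_Z ∘ g
  end.

Lemma tp_comp_a : tp_comp a ≈ tp_Y ∘ f.
Proof. by rewrite /tp_comp insubN /= ?eqxx. Qed.

Lemma tp_comp_b : tp_comp b ≈ tp_Z ∘ g.
Proof. by rewrite /tp_comp insubN /= ?eqxx ?andbF // eq_sym (negPf ab). Qed.

Lemma tp_comp_m (m : M) : tp_comp (val m) ≈ tp_M ∘ cop_in MA m.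
Proof. by rewrite /tp_comp valK. Qed.

Definition tp_desc (T : C) (h : hom (cop_ob KA) T) (l : hom (bc_ob YZ) T) :
  hom tp_ob T :=
  copair YMZ
    (copair YM (l ∘ in1 YZ) (cop_desc MA (fun m => h ∘ cop_in KA (val m))))
    (l ∘ in2 YZ).

Lemma tp_desc_Y (T : C) (h : hom (cop_ob KA) T) (l : hom (bc_ob YZ) T) :
  tp_desc h l ∘ tp_Y ≈ l ∘ in1 YZ.
Proof. by rewrite /tp_desc /tp_Y compA !copair1. Qed.

Lemma tp_desc_M (T : C) (h : hom (cop_ob KA) T) (l : hom (bc_ob YZ) T) m :
  tp_desc h l ∘ tp_M ∘ cop_in MA m ≈ h ∘ cop_in KA (val m).
Proof. by rewrite /tp_desc /tp_M !compA copair1 copair2 cop_descE. Qed.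

Lemma tp_desc_Z (T : C) (h : hom (cop_ob KA) T) (l : hom (bc_ob YZ) T) :
  tp_desc h l ∘ tp_Z ≈ l ∘ in2 YZ.
Proof. by rewrite /tp_desc /tp_Z copair2. Qed.

Lemma tp_square (T : C) (h : hom (cop_ob KA) T) (l : hom (bc_ob YZ) T) :
  h ∘ u ≈ l ∘ v ->
  h ∘ cop_in KA a ≈ l ∘ in1 YZ ∘ f /\
  h ∘ cop_in KA b ≈ l ∘ in2 YZ ∘ g.
Proof. by move=> e; rewrite -ua -ub !compA e -!compA vf vg. Qed.

Definition two_points_pushout : Pushout u v.
Proof.
refine (@MkPushout C _ _ _ u v tp_ob (cop_desc KA tp_comp)
  (copair YZ tp_Y tp_Z) _ (fun T h l _ => tp_desc h l) _ _ _).
- apply: bc_uniq; rewrite -!compA.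
    by rewrite ua vf compA copair1 cop_descE tp_comp_a.
  by rewrite ub vg compA copair2 cop_descE tp_comp_b.
- move=> T h l e; apply: cop_uniq => k; rewrite -compA cop_descE.
  have [ea eb] := tp_square e.
  have [->|ka] := eqVneq k a; first by rewrite tp_comp_a compA tp_desc_Y ea.
  have [->|kb] := eqVneq k b; first by rewrite tp_comp_b compA tp_desc_Z eb.
  have km : (k != a) && (k != b) by rewrite ka kb.
  rewrite (_ : k = val (exist _ k km : M)) //.
  by rewrite tp_comp_m compA tp_desc_M.
- move=> T h l e; apply: bc_uniq; rewrite -compA.
    by rewrite copair1 tp_desc_Y.
  by rewrite copair2 tp_desc_Z.
- move=> T w w' e1 e2; apply: bc_uniq; first apply: bc_uniq.
  + have := comp_heq e2 (reflexivity (in1 YZ)).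
    by rewrite -!compA !copair1 /tp_Y => ->.
  + apply: cop_uniq => m.
    have := comp_heq e1 (reflexivity (cop_in KA (val m))).
    by rewrite -!compA !cop_descE tp_comp_m /tp_M -!compA => ->.
  + have := comp_heq e2 (reflexivity (in2 YZ)).
    by rewrite -!compA !copair2 /tp_Z => ->.
Defined.

End TwoPoints.

Definition monotone (m n : nat) (f : {ffun 'I_m.+1 -> 'I_n.+1}) : bool :=
  [forall i : 'I_m.+1, forall j : 'I_m.+1, (i <= j) ==> (f i <= f j)].

Definition dhom (m n : nat) : finType :=
  {f : {ffun 'I_m.+1 -> 'I_n.+1} | monotone f}.

Lemma monotoneP (m n : nat) (f : {ffun 'I_m.+1 -> 'I_n.+1}) :
  reflect (forall i j : 'I_m.+1, i <= j -> f i <= f j) (monotone f).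
Proof.
apply: (iffP forallP) => [h i j ij|h i]; last by apply/forallP => j; apply/implyP; apply: h.
by move: (h i) => /forallP /(_ j) /implyP; apply.
Qed.

Definition mkd (m n : nat) (f : 'I_m.+1 -> 'I_n.+1)
  (fm : forall i j : 'I_m.+1, i <= j -> f i <= f j) : dhom m n.
Proof.
refine (exist _ (finfun f) _).
by apply/monotoneP => i j ij; rewrite !ffunE; apply: fm.
Defined.

Definition did (n : nat) : dhom n n := @mkd n n (fun i => i) (fun i j ij => ij).

Definition dcomp (l m n : nat) (g : dhom m n) (f : dhom l m) : dhom l n :=
  @mkd l n (fun i => val g (val f i))
    (fun i j ij => elimT (monotoneP _) (valP g) _ _
                     (elimT (monotoneP _) (valP f) _ _ ij)).

Lemma dhom_eq (m n : nat) (f g : dhom m n) : (forall i, val f i = val g i) -> f = g.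
Proof. by move=> e; apply: val_inj; apply/ffunP. Qed.

(** The object [n] of [Delta] is the ordered set [0 < 1 < ... < n]. *)
Definition Delta : Category.
Proof.
refine (@MkCategory nat dhom (fun m n f g => f = g) did dcomp _ _ _ _ _).
- by move=> x y g g' f f' z -> ->.
- by move=> k l m n h g f; apply: dhom_eq => i; rewrite !ffunE.
- by move=> m n f; apply: dhom_eq => i; rewrite !ffunE.
- by move=> m n f; apply: dhom_eq => i; rewrite !ffunE.
Defined.

(** The [i]-th coface [n] -> [n+1], which omits [i]. *)
Definition coface (n : nat) (i : 'I_n.+2) : dhom n n.+1.
Proof. by refine (@mkd n n.+1 (lift i) _) => j k jk; rewrite /= leq_bump2. Defined.

Definition to_point (n : nat) : dhom n 0.
Proof. by refine (@mkd n 0 (fun _ => ord0) _). Defined.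

Lemma to_point_uniq (n : nat) (f g : dhom n 0) : f = g.
Proof. by apply: dhom_eq => i; rewrite !ord1. Qed.

(** Order reversal; it exchanges the [i]-th and the [(n - i)]-th cofaces. *)
Definition drev (m n : nat) (f : dhom m n) : dhom m n.
Proof.
refine (@mkd m n (fun i => rev_ord (val f (rev_ord i))) _) => i j ij /=.
apply: leq_sub2l; rewrite ltnS; apply: (elimT (monotoneP _) (valP f)).
by rewrite /=; apply: leq_sub2l.
Defined.

Definition Rev : Functor Delta Delta.
Proof.
refine (@MkFunctor Delta Delta (fun n => n) drev _ _ _).
- by move=> m n f g /= ->.
- by move=> n; apply: dhom_eq => i; rewrite !ffunE rev_ordK.
- by move=> l m n g f; apply: dhom_eq => i; rewrite !ffunE rev_ordK.
Defined.

Definition Simp (D : Category) : Category := Fun (op Delta) D.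
Definition Bisimp (D : Category) : Category := Simp (Simp D).

Definition Upsilon (D : Category) : Functor (Simp D) (Simp D) :=
  Pre D (opF Rev).

(** The constant simplicial object on [A], and the two ways of viewing a
    simplicial object as a bisimplicial one: [(leftconst X)_(n,m) = X_m] and
    [(rightconst X)_(n,m) = X_n]. *)
Definition SConst (D : Category) : Functor D (Simp D) := Const (op Delta) D.
Definition leftconst (D : Category) : Functor (Simp D) (Bisimp D) :=
  Const (op Delta) (Simp D).
Definition rightconst (D : Category) : Functor (Simp D) (Bisimp D) :=
  Post (op Delta) (SConst D).

Definition diag_ob (D : Category) (Z : Bisimp D) : Functor (op Delta) D.
Proof.
refine (@MkFunctor (op Delta) D (fun n => fob (fob Z n) n)
  (fun n m t => ntc (fmap Z t) m ∘ fmap (fob Z n) t) _ _ _).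
- by move=> n m t t' e; rewrite e.
- by move=> n; rewrite (fmap1 Z n n) fmap1 comp1m.
- move=> n m k t' t; rewrite (fmapM Z t' t k) /= fmapM -!compA.
  by apply: comp_heq => //; rewrite !compA nt_nat.
Defined.

Definition diag_map (D : Category) (Z W : Bisimp D) (a : hom Z W) :
  NatTrans (diag_ob Z) (diag_ob W).
Proof.
refine (@MkNatTrans (op Delta) D (diag_ob Z) (diag_ob W)
  (fun n => ntc (ntc a n) n) _).
move=> n m t /=.
have e : ntc (ntc a m) m ∘ ntc (fmap Z t) m ≈
         ntc (fmap W t) m ∘ ntc (ntc a n) m by apply: (nt_nat a t m).
by rewrite compA e -!compA nt_nat.
Defined.

Definition Diag (D : Category) : Functor (Bisimp D) (Simp D).
Proof.
refine (@MkFunctor (Bisimp D) (Simp D) (@diag_ob D) (@diag_map D) _ _ _).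
- by move=> Z W a b e n; apply: e.
- by move=> Z n.
- by move=> Z W V b a n.
Defined.

Definition FinSet : Category.
Proof.
refine (@MkCategory finType (fun I J => I -> J) (fun I J f g => forall x, f x = g x)
  (fun I x => x) (fun I J K g f x => g (f x)) _ _ _ _ _) => //.
- move=> I J; split.
  + by [].
  + by move=> f g e x.
  + by move=> f g h e1 e2 x; rewrite e1.
- by move=> I J K g g' f f' eg ef x; rewrite ef eg.
Defined.

Definition std (k : nat) : Functor (op Delta) FinSet.
Proof.
refine (@MkFunctor (op Delta) FinSet (fun n => dhom n k)
  (fun n m t u => dcomp u t) _ _ _).
- by move=> n m t t' /= ->.
- by move=> n u; apply: dhom_eq => i; rewrite !ffunE.
- by move=> n m l t' t u; apply: dhom_eq => i; rewrite !ffunE.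
Defined.

Definition std_map (k l : nat) (t : dhom k l) : NatTrans (std k) (std l).
Proof.
refine (@MkNatTrans (op Delta) FinSet (std k) (std l) (fun n u => dcomp t u) _).
by move=> n m s u; apply: dhom_eq => i; rewrite !ffunE.
Defined.

Section Cylinders.
Context (D : Category) (cop : FinCoproducts D).

(** [K ⊠ X], with [(K ⊠ X)_n] the coproduct of copies of [X_n] indexed by [K_n]. *)
Definition box_cop (K : Functor (op Delta) FinSet) (X : Simp D) (n : op Delta) :
  Coproduct (fun _ : fob K n => fob X n) := @cop (fob K n) (fun=> fob X n).

Definition box (K : Functor (op Delta) FinSet) (X : Simp D) : Simp D.
Proof.
refine (@MkFunctor (op Delta) D (fun n => cop_ob (box_cop K X n))
  (fun n m t => cop_desc (box_cop K X n)
     (fun k => cop_in (box_cop K X m) (fmap K t k) ∘ fmap X t)) _ _ _).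
- by move=> n m t t' e; apply: cop_uniq => k; rewrite !cop_descE e.
- move=> n; apply: cop_uniq => k; rewrite cop_descE (fmap1 X) comp1m compm1.
  have ek : fmap K (idm n) k = k by apply: (fmap1 K n).
  by rewrite ek.
- move=> n m l t' t; apply: cop_uniq => k.
  rewrite cop_descE -compA cop_descE compA cop_descE (fmapM X) compA.
  have ek : fmap K (t' ∘ t) k = fmap K t' (fmap K t k) by apply: (fmapM K t' t).
  by rewrite ek.
Defined.

Definition box_map (K L : Functor (op Delta) FinSet) (c : NatTrans K L)
  (X Y : Simp D) (a : NatTrans X Y) : NatTrans (box K X) (box L Y).
Proof.
refine (@MkNatTrans (op Delta) D (box K X) (box L Y)
  (fun n => cop_desc (box_cop K X n)
     (fun k => cop_in (box_cop L Y n) (c n k) ∘ a n)) _).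
move=> n m t; apply: cop_uniq => k /=.
rewrite -!compA !cop_descE !compA !cop_descE -!compA (nt_nat a).
have ek : c m (fmap K t k) = fmap L t (c n k) by apply: (nt_nat c t).
by rewrite ek.
Defined.

(** The canonical isomorphism between [X] and [Δ[0] ⊠ X]. *)
Definition to_box0 (X : Simp D) : NatTrans X (box (std 0) X).
Proof.
refine (@MkNatTrans (op Delta) D X (box (std 0) X)
  (fun n => cop_in (box_cop (std 0) X n) (to_point n)) _).
move=> n m t /=; rewrite cop_descE.
by rewrite (to_point_uniq (to_point m) (dcomp (to_point n) t)).
Defined.

Definition of_box0 (X : Simp D) : NatTrans (box (std 0) X) X.
Proof.
refine (@MkNatTrans (op Delta) D (box (std 0) X) X
  (fun n => cop_desc (box_cop (std 0) X n) (fun _ => idm (fob X n))) _).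
move=> n m t; apply: cop_uniq => k /=.
by rewrite -!compA !cop_descE compA cop_descE compm1 comp1m.
Defined.

(** The maps [d^i : X -> X ⊠ Δ[1]] and [s^0 : X ⊠ Δ[1] -> X]. *)
Definition dmap (i : 'I_2) (X : Simp D) : NatTrans X (box (std 1) X) :=
  compN (box_map (std_map (@coface 0 i)) (idN X)) (to_box0 X).

Definition smap (X : Simp D) : NatTrans (box (std 1) X) X :=
  compN (of_box0 X) (box_map (std_map (to_point 1)) (idN X)).

Definition d0 : forall X : Simp D, NatTrans X (box (std 1) X) := dmap ord0.
Definition d1 : forall X : Simp D, NatTrans X (box (std 1) X) := dmap ord_max.

Definition vertex (i : 'I_2) (n : nat) : dhom n 1 :=
  dcomp (@coface 0 i) (to_point n).

Lemma dmapE (i : 'I_2) (X : Simp D) n :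
  dmap i X n ≈ cop_in (box_cop (std 1) X n) (vertex i n).
Proof. by rewrite /dmap /= cop_descE /= compm1. Qed.

Lemma vertex01 n : vertex ord0 n != vertex ord_max n.
Proof.
apply/eqP => /(congr1 (fun f : dhom n 1 => nat_of_ord (val f ord0))).
by rewrite !ffunE.
Qed.

Lemma smap_dmap (i : 'I_2) (X : Simp D) n : smap X n ∘ dmap i X n ≈ idm (fob X n).
Proof. by rewrite dmapE /= -compA cop_descE compA cop_descE comp1m. Qed.

Lemma dmap_nat (i : 'I_2) (X Y : Simp D) (a : NatTrans X Y) n :
  box_map (idN (std 1)) a n ∘ dmap i X n ≈ dmap i Y n ∘ a n.
Proof. by rewrite !dmapE /= cop_descE. Qed.

Definition scop (X Y : Simp D) : @BinCoproduct (Simp D) X Y :=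
  bcop (@Fun_coproducts (op Delta) D cop) X Y.

Definition scop_at (X Y : Simp D) (n : op Delta) :
  BinCoproduct (fob X n) (fob Y n).
Proof.
pose S := @cop bool (fun b => fob (bfam X Y b) n).
pose h T (f : hom (fob X n) T) (g : hom (fob Y n) T) (b : bool) :
  hom (fob (bfam X Y b) n) T := match b with true => f | false => g end.
refine (@MkBinCoproduct D (fob X n) (fob Y n) (fob (bc_ob (scop X Y)) n)
  (ntc (in1 (scop X Y)) n) (ntc (in2 (scop X Y)) n)
  (fun T f g => cop_desc S (h T f g)) _ _ _).
- by move=> T f g; exact: (cop_descE S (h T f g) true).
- by move=> T f g; exact: (cop_descE S (h T f g) false).
- by move=> T u v e1 e2; apply: (@cop_uniq _ _ _ S) => -[].
Defined.

(** The pushout defining [Cyl f g]; it is computed degreewise, with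
    [Cyl(f, g)_n = Y_n ⊔ (∐ X_n) ⊔ Z_n], the middle coproduct being indexed by the
    non-constant elements of [Δ[1]_n]. *)
Definition Cyl_pushout (X Y Z : Simp D) (f : hom X Y) (g : hom X Z) :
  @Pushout (Simp D) _ _ _ (copair (scop X X) (d0 X) (d1 X))
    (bc_map (scop X X) (scop Y Z) f g).
Proof.
apply: Fun_pushout => n.
apply: (@two_points_pushout D cop (std 1 n) (vertex ord0 n) (vertex ord_max n)
  (vertex01 n) (fob X n) (fob Y n) (fob Z n) (ntc f n) (ntc g n)
  (scop_at X X n) (scop_at Y Z n)).
- transitivity (d0 X n); last exact: dmapE.
  exact: (copair1 (scop X X) (d0 X : hom X _) (d1 X) n).
- transitivity (d1 X n); last exact: dmapE.
  exact: (copair2 (scop X X) (d0 X : hom X _) (d1 X) n).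
- exact: (copair1 (scop X X) (in1 (scop Y Z) ∘ f) (in2 (scop Y Z) ∘ g) n).
- exact: (copair2 (scop X X) (in1 (scop Y Z) ∘ f) (in2 (scop Y Z) ∘ g) n).
Defined.

Definition Cyl (X Y Z : Simp D) (f : hom X Y) (g : hom X Z) : Simp D :=
  po_ob (Cyl_pushout f g).
Definition Cyl_I (X Y Z : Simp D) (f : hom X Y) (g : hom X Z) :
  hom Y (Cyl f g) := po_inr (Cyl_pushout f g) ∘ in1 (scop Y Z).
Definition Cyl_J (X Y Z : Simp D) (f : hom X Y) (g : hom X Z) :
  hom Z (Cyl f g) := po_inr (Cyl_pushout f g) ∘ in2 (scop Y Z).

Definition Cyl_map (X Y Z X' Y' Z' : Simp D)
  (f : hom X Y) (g : hom X Z) (f' : hom X' Y') (g' : hom X' Z')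
  (y : hom Y Y') (x : hom X X') (z : hom Z Z')
  (yf : y ∘ f ≈ f' ∘ x) (zg : z ∘ g ≈ g' ∘ x) : hom (Cyl f g) (Cyl f' g') :=
  dcyl_map (Cyl_pushout f g) (Cyl_pushout f' g')
    (w := box_map (idN (std 1)) x)
    (fun n => dmap_nat ord0 x n) (fun n => dmap_nat ord_max x n) yf zg.

Lemma Cyl_map_I (X Y Z X' Y' Z' : Simp D)
  (f : hom X Y) (g : hom X Z) (f' : hom X' Y') (g' : hom X' Z')
  (y : hom Y Y') (x : hom X X') (z : hom Z Z')
  (yf : y ∘ f ≈ f' ∘ x) (zg : z ∘ g ≈ g' ∘ x) :
  Cyl_map yf zg ∘ Cyl_I f g ≈ Cyl_I f' g' ∘ y.
Proof. exact: dcyl_map1. Qed.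

Lemma Cyl_map_J (X Y Z X' Y' Z' : Simp D)
  (f : hom X Y) (g : hom X Z) (f' : hom X' Y') (g' : hom X' Z')
  (y : hom Y Y') (x : hom X X') (z : hom Z Z')
  (yf : y ∘ f ≈ f' ∘ x) (zg : z ∘ g ≈ g' ∘ x) :
  Cyl_map yf zg ∘ Cyl_J f g ≈ Cyl_J f' g' ∘ z.
Proof. exact: dcyl_map2. Qed.

(** The canonical isomorphism [Cyl(Id, Id) -> X ⊠ Δ[1]]. *)
Definition Cyl_fold (X : Simp D) (f g : hom X X)
  (ef : f ≈ idm X) (eg : g ≈ idm X) : hom (Cyl f g) (box (std 1) X) :=
  dcyl_fold (Cyl_pushout f g) ef eg.

Lemma Cyl_fold_I (X : Simp D) (f g : hom X X) (ef : f ≈ idm X) (eg : g ≈ idm X) :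
  Cyl_fold ef eg ∘ Cyl_I f g ≈ (d0 X : hom X _).
Proof. exact: dcyl_fold1. Qed.

Lemma Cyl_fold_J (X : Simp D) (f g : hom X X) (ef : f ≈ idm X) (eg : g ≈ idm X) :
  Cyl_fold ef eg ∘ Cyl_J f g ≈ (d1 X : hom X _).
Proof. exact: dcyl_fold2. Qed.

Context (ter : Terminal D).

Definition Cone (X Y : Simp D) (f : hom X Y) : Simp D :=
  Cyl f (ter_map (Fun_terminal (op Delta) ter) X).

End Cylinders.

Section SimpleFunctor.
Context (D : Category) (E : MorClass D) (s : Functor (Simp D) D).

(** [R = s(- × Δ)] and [(ss) Z = s(n ↦ s(m ↦ Z_(n,m)))]. *)
Definition RF : Functor D D := s ∘F SConst D.
Definition sdiag : Functor (Bisimp D) D := s ∘F Diag D.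
Definition sspl : Functor (Bisimp D) D := s ∘F Post (op Delta) s.

(** The identifications [D(Δ × X) = X = D(X × Δ)] and [ss(Δ × X) = R(s X)], all of
    them given by identities. *)
Definition diag_leftconst (X : Simp D) : hom X (fob (Diag D) (leftconst D X)).
Proof.
refine (@MkNatTrans (op Delta) D X (diag_ob (leftconst D X))
  (fun n => idm (fob X n)) _).
by move=> n m t /=; rewrite compm1 !comp1m.
Defined.

Definition diag_rightconst (X : Simp D) : hom X (fob (Diag D) (rightconst D X)).
Proof.
refine (@MkNatTrans (op Delta) D X (diag_ob (rightconst D X))
  (fun n => idm (fob X n)) _).
by move=> n m t /=; rewrite !compm1 comp1m.
Defined.

Definition s_leftconst (X : Simp D) :
  hom (s ∘F leftconst D X : Simp D) (SConst D (s X)).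
Proof.
refine (@MkNatTrans (op Delta) D (s ∘F leftconst D X) (SConst D (s X))
  (fun n => idm (s X)) _).
by move=> n m t /=; rewrite fmap1 compm1.
Defined.

Definition sdiag_left : NatTrans s (sdiag ∘F leftconst D).
Proof.
refine (@MkNatTrans (Simp D) D s (sdiag ∘F leftconst D)
  (fun X => fmap s (diag_leftconst X)) _).
by move=> X Y f /=; rewrite -!fmapM; apply: fmap_heq => n /=; rewrite comp1m compm1.
Defined.

Definition sdiag_right : NatTrans s (sdiag ∘F rightconst D).
Proof.
refine (@MkNatTrans (Simp D) D s (sdiag ∘F rightconst D)
  (fun X => fmap s (diag_rightconst X)) _).
by move=> X Y f /=; rewrite -!fmapM; apply: fmap_heq => n /=; rewrite comp1m compm1.
Defined.

Context (l : NatTrans RF (idF D)).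

(** [λ_(s X) : ss(Δ × X) = R(s X) -> s X]. *)
Definition lambda_left : NatTrans (sspl ∘F leftconst D) s.
Proof.
refine (@MkNatTrans (Simp D) D (sspl ∘F leftconst D) s
  (fun X => l (s X) ∘ fmap s (s_leftconst X)) _).
move=> X Y f /=.
rewrite compA -(nt_nat l (fmap s f)) /= -!compA -!fmapM.
by apply: comp_heq => //; apply: fmap_heq => n /=; rewrite comp1m compm1.
Defined.

(** [s(λ_X) : ss(X × Δ) = s(R X) -> s X]. *)
Definition lambda_obj (X : Simp D) : hom (s ∘F rightconst D X : Simp D) X.
Proof.
refine (@MkNatTrans (op Delta) D (s ∘F rightconst D X) X (fun n => l (fob X n)) _).
by move=> n m t /=; exact: (nt_nat l (fmap X t)).
Defined.

Definition lambda_right : NatTrans (sspl ∘F rightconst D) s.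
Proof.
refine (@MkNatTrans (Simp D) D (sspl ∘F rightconst D) s
  (fun X => fmap s (lambda_obj X)) _).
move=> X Y f /=; rewrite -!fmapM; apply: fmap_heq => n /=.
exact: (nt_nat l (ntc f n)).
Defined.

Definition acyclic (t : Terminal D) (A : D) : Prop := E (ter_map t A).

End SimpleFunctor.

(** The initial object is [sd_cop] of the empty family.  As [μ] is only a morphism
    of the localized functor category, its components at [Δ × X] and [X × Δ],
    natural in [X], are the images of [μ] under [LocPre]. *)
Record SimplicialDescentCategory := MkSDC {
  sd_cat :> Category;
  sd_cop : FinCoproducts sd_cat;
  sd_ter : Terminal sd_cat;
  sd_E : MorClass sd_cat;
  sd_saturated : forall (x y : sd_cat) (f : hom x y),
    sd_E f <-> is_iso (fmap (toLoc sd_E) f);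
  sd_E_cop : forall (x y x' y' : sd_cat) (f : hom x y) (f' : hom x' y'),
    sd_E f -> sd_E f' -> sd_E (bc_map (bcop sd_cop x x') (bcop sd_cop y y') f f');
  sd_s : Functor (Simp sd_cat) sd_cat;
  sd_s_cop : forall X Y : Simp sd_cat,
    sd_E (copair (bcop sd_cop (sd_s X) (sd_s Y))
            (fmap sd_s (in1 (scop sd_cop X Y))) (fmap sd_s (in2 (scop sd_cop X Y))));
  sd_mu : @hom (Loc (objwise sd_E)) (sdiag sd_s) (sspl sd_s);
  sd_mu_iso : is_iso sd_mu;
  sd_lambda : NatTrans (RF sd_s) (idF sd_cat);
  sd_lambda_E : forall A : sd_cat, sd_E (sd_lambda A);
  sd_rho : NatTrans (idF sd_cat) (RF sd_s);
  sd_lambda_rho : forall A : sd_cat, sd_lambda A ∘ sd_rho A ≈ idm A;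
  sd_exact : forall (X Y : Simp sd_cat) (f : hom X Y),
    (forall n, sd_E (ntc f n)) -> sd_E (fmap sd_s f);
  sd_cone : forall (A B : sd_cat) (f : hom A B),
    sd_E f <->
    acyclic sd_E sd_ter (sd_s (Cone sd_cop sd_ter (fmap (SConst sd_cat) f)));
  sd_Upsilon : forall (X Y : Simp sd_cat) (f : hom X Y),
    sd_E (fmap sd_s (fmap (Upsilon sd_cat) f)) <-> sd_E (fmap sd_s f);
  sd_compat_left :
    fmap (toLoc (objwise sd_E)) (lambda_left sd_lambda)
      ∘ fmap (LocPre sd_E (leftconst sd_cat)) sd_mu
      ∘ fmap (toLoc (objwise sd_E)) (sdiag_left sd_s)
    ≈ idm (sd_s : Loc (objwise sd_E));
  sd_compat_right :
    fmap (toLoc (objwise sd_E)) (lambda_right sd_lambda)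
      ∘ fmap (LocPre sd_E (rightconst sd_cat)) sd_mu
      ∘ fmap (toLoc (objwise sd_E)) (sdiag_right sd_s)
    ≈ idm (sd_s : Loc (objwise sd_E))
}.

Section Homotopy.
Context (D : SimplicialDescentCategory).

Notation Dt := (sd_cat D).
Notation cop := (@sd_cop D).
Notation s := (sd_s D).
Notation lam := (sd_lambda D).
Notation rho := (sd_rho D).
Notation "A ×Δ" := (fob (SConst Dt) A) (at level 1, format "A ×Δ").
Notation "f ××Δ" := (fmap (SConst Dt) f) (at level 1, format "f ××Δ").

Definition cyl (A B C : Dt) (f : hom A B) (g : hom A C) : Dt :=
  s (Cyl cop f××Δ g××Δ).

Definition cyl_i (A B C : Dt) (f : hom A B) (g : hom A C) : hom B (cyl f g) :=
  fmap s (Cyl_I cop f××Δ g××Δ) ∘ rho B.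

Definition cyl_j (A B C : Dt) (f : hom A B) (g : hom A C) : hom C (cyl f g) :=
  fmap s (Cyl_J cop f××Δ g××Δ) ∘ rho C.

Lemma SConst_square (A B A' B' : Dt) (f : hom A B) (f' : hom A' B')
  (x : hom A A') (y : hom B B') :
  y ∘ f ≈ f' ∘ x -> y××Δ ∘ f××Δ ≈ f'××Δ ∘ x××Δ.
Proof. by move=> e n. Qed.

Definition cyl_map (A B C A' B' C' : Dt) (f : hom A B) (g : hom A C)
  (f' : hom A' B') (g' : hom A' C') (y : hom B B') (x : hom A A') (z : hom C C')
  (yf : y ∘ f ≈ f' ∘ x) (zg : z ∘ g ≈ g' ∘ x) : hom (cyl f g) (cyl f' g') :=
  fmap s (Cyl_map cop (SConst_square yf) (SConst_square zg)).

Lemma cyl_map_i (A B C A' B' C' : Dt) (f : hom A B) (g : hom A C)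
  (f' : hom A' B') (g' : hom A' C') (y : hom B B') (x : hom A A') (z : hom C C')
  (yf : y ∘ f ≈ f' ∘ x) (zg : z ∘ g ≈ g' ∘ x) :
  cyl_map yf zg ∘ cyl_i f g ≈ cyl_i f' g' ∘ y.
Proof.
rewrite /cyl_i -compA (nt_nat rho y) !compA /cyl_map -!fmapM.
apply: comp_heq => //.
transitivity (fmap s (Cyl_I cop f'××Δ g'××Δ ∘ y××Δ)); last exact: fmapM.
by apply: fmap_heq; exact: Cyl_map_I.
Qed.

Lemma cyl_map_j (A B C A' B' C' : Dt) (f : hom A B) (g : hom A C)
  (f' : hom A' B') (g' : hom A' C') (y : hom B B') (x : hom A A') (z : hom C C')
  (yf : y ∘ f ≈ f' ∘ x) (zg : z ∘ g ≈ g' ∘ x) :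
  cyl_map yf zg ∘ cyl_j f g ≈ cyl_j f' g' ∘ z.
Proof.
rewrite /cyl_j -compA (nt_nat rho z) !compA /cyl_map -!fmapM.
apply: comp_heq => //.
transitivity (fmap s (Cyl_J cop f'××Δ g'××Δ ∘ z××Δ)); last exact: fmapM.
by apply: fmap_heq; exact: Cyl_map_J.
Qed.

(** [cyl(A) = s(Δ[1] ⊠ A)], its identification with [cyl(Id, Id)], and [σ_A]. *)
Definition cylA (A : Dt) : Dt := s (box cop (std 1) A×Δ).

Definition cyl_fold (A : Dt) : hom (cyl (idm A) (idm A)) (cylA A) :=
  fmap s (Cyl_fold cop (f := (idm A)××Δ) (g := (idm A)××Δ)
            (fmap1 (SConst Dt) A) (fmap1 (SConst Dt) A)).

Definition sigma (A : Dt) : hom (cylA A) A :=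
  lam A ∘ fmap s (smap cop A×Δ : hom (box cop (std 1) A×Δ) A×Δ).

Lemma sigma_i (A : Dt) : sigma A ∘ cyl_fold A ∘ cyl_i (idm A) (idm A) ≈ idm A.
Proof.
pose S : hom (box cop (std 1) A×Δ) A×Δ := smap cop A×Δ.
pose F := Cyl_fold cop (f := (idm A)××Δ) (g := (idm A)××Δ)
            (fmap1 (SConst Dt) A) (fmap1 (SConst Dt) A).
pose I := Cyl_I cop (idm A)××Δ (idm A)××Δ.
have e : S ∘ (F ∘ I) ≈ idm A×Δ by rewrite /F /I Cyl_fold_I => n; apply: smap_dmap.
transitivity (lam A ∘ (fmap s (S ∘ (F ∘ I)) ∘ rho A)); first exact: fmap_chain.
by rewrite e fmap1 comp1m sd_lambda_rho.
Qed.

Lemma sigma_j (A : Dt) : sigma A ∘ cyl_fold A ∘ cyl_j (idm A) (idm A) ≈ idm A.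
Proof.
pose S : hom (box cop (std 1) A×Δ) A×Δ := smap cop A×Δ.
pose F := Cyl_fold cop (f := (idm A)××Δ) (g := (idm A)××Δ)
            (fmap1 (SConst Dt) A) (fmap1 (SConst Dt) A).
pose I := Cyl_J cop (idm A)××Δ (idm A)××Δ.
have e : S ∘ (F ∘ I) ≈ idm A×Δ by rewrite /F /I Cyl_fold_J => n; apply: smap_dmap.
transitivity (lam A ∘ (fmap s (S ∘ (F ∘ I)) ∘ rho A)); first exact: fmap_chain.
by rewrite e fmap1 comp1m sd_lambda_rho.
Qed.

(** The map [σ_T ∘ cyl(y, x, z) : cyl(f, g) -> T] given by a cocone [y f = x = z g]. *)
Section Desc.
Context (A B C T : Dt) (f : hom A B) (g : hom A C).
Context (y : hom B T) (x : hom A T) (z : hom C T).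
Context (yf : y ∘ f ≈ idm T ∘ x) (zg : z ∘ g ≈ idm T ∘ x).

Definition cyl_desc : hom (cyl f g) T := sigma T ∘ cyl_fold T ∘ cyl_map yf zg.

Lemma cyl_desc_i : cyl_desc ∘ cyl_i f g ≈ y.
Proof. by rewrite /cyl_desc -compA cyl_map_i compA sigma_i comp1m. Qed.

Lemma cyl_desc_j : cyl_desc ∘ cyl_j f g ≈ z.
Proof. by rewrite /cyl_desc -compA cyl_map_j compA sigma_j comp1m. Qed.

End Desc.

Record CylTriple (A : Dt) := MkCylTriple {
  ct_ob : Dt;
  ct_i : hom A ct_ob;
  ct_j : hom A ct_ob;
  ct_nu : hom ct_ob A;
  ct_nui : ct_nu ∘ ct_i ≈ idm A;
  ct_nuj : ct_nu ∘ ct_j ≈ idm A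
}.

Definition ct_id (A : Dt) : CylTriple A :=
  MkCylTriple (comp1m (idm A)) (comp1m (idm A)).

Definition ct_sym (A : Dt) (c : CylTriple A) : CylTriple A :=
  MkCylTriple (ct_nuj c) (ct_nui c).

(** The gluing of [c = (i, j, ν)] and [d = (p, q, ϱ)], with
    [η = σ_A ∘ cyl(ϱ, Id, ν) : cyl(p, j) -> A]. *)
Section Gluing.
Context (A : Dt) (c d : CylTriple A).

Lemma glue_square (u : hom A A) : u ≈ idm A -> u ≈ idm A ∘ idm A.
Proof. by move=> ->; rewrite comp1m. Qed.

Definition glue_eta : hom (cyl (ct_i d) (ct_j c)) A :=
  cyl_desc (glue_square (ct_nui d))
           (glue_square (ct_nuj c)).

Lemma glue_etas : glue_eta ∘ (cyl_j (ct_i d) (ct_j c) ∘ ct_i c) ≈ idm A.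
Proof. by rewrite compA cyl_desc_j ct_nui. Qed.

Lemma glue_etat : glue_eta ∘ (cyl_i (ct_i d) (ct_j c) ∘ ct_j d) ≈ idm A.
Proof. by rewrite compA cyl_desc_i ct_nuj. Qed.

Definition ct_glue : CylTriple A := MkCylTriple glue_etas glue_etat.

End Gluing.

Inductive admissible (A : Dt) : CylTriple A -> Prop :=
| adm_id : admissible (ct_id A)
| adm_sym c : admissible c -> admissible (ct_sym c)
| adm_glue c d : admissible c -> admissible d -> admissible (ct_glue c d).

Definition homotopic (A B : Dt) (f g : hom A B) : Prop :=
  exists c : CylTriple A, admissible c /\
  exists H : hom (ct_ob c) B, H ∘ ct_i c ≈ f /\ H ∘ ct_j c ≈ g.

Lemma heq_homotopic (A B : Dt) (f g : hom A B) : f ≈ g -> homotopic f g.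
Proof.
move=> e; exists (ct_id A); split; first exact: adm_id.
by exists f; rewrite /= !compm1.
Qed.

Lemma homotopic_sym (A B : Dt) (f g : hom A B) : homotopic f g -> homotopic g f.
Proof.
move=> [c [ac [H [e1 e2]]]]; exists (ct_sym c); split; first exact: adm_sym.
by exists H.
Qed.

Lemma homotopic_trans (A B : Dt) (f g h : hom A B) :
  homotopic f g -> homotopic g h -> homotopic f h.
Proof.
move=> [c [ac [H [e1 e2]]]] [d [ad [K [e3 e4]]]].
exists (ct_glue c d); split; first exact: adm_glue.
have yf : K ∘ ct_i d ≈ idm B ∘ g by rewrite e3 comp1m.
have zg : H ∘ ct_j c ≈ idm B ∘ g by rewrite e2 comp1m.
exists (cyl_desc yf zg); split.
  transitivity (cyl_desc yf zg ∘ cyl_j (ct_i d) (ct_j c) ∘ ct_i c).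
    exact: compA.
  by rewrite cyl_desc_j.
transitivity (cyl_desc yf zg ∘ cyl_i (ct_i d) (ct_j c) ∘ ct_j d).
  exact: compA.
by rewrite cyl_desc_i.
Qed.

Lemma homotopic_postcomp (A B C : Dt) (k : hom B C) (f g : hom A B) :
  homotopic f g -> homotopic (k ∘ f) (k ∘ g).
Proof.
move=> [c [ac [H [e1 e2]]]]; exists c; split=> //.
by exists (k ∘ H); rewrite -!compA e1 e2.
Qed.

Lemma admissible_pullback (A' A : Dt) (k : hom A' A) (c : CylTriple A) :
  admissible c -> exists2 c' : CylTriple A', admissible c' &
    exists K : hom (ct_ob c') (ct_ob c),
      K ∘ ct_i c' ≈ ct_i c ∘ k /\ K ∘ ct_j c' ≈ ct_j c ∘ k.
Proof.
elim=> [|{}c _ [c' ac' [K [e1 e2]]]|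
  {}c d _ [c' ac' [K [e1 e2]]] _ [d' ad' [L [e3 e4]]]].
- exists (ct_id A'); first exact: adm_id.
  by exists k; rewrite /= comp1m compm1.
- by exists (ct_sym c'); [exact: adm_sym | exists K].
- exists (ct_glue c' d'); first exact: adm_glue.
  exists (cyl_map e3 e2); split.
    transitivity (cyl_map e3 e2 ∘ cyl_j (ct_i d') (ct_j c') ∘ ct_i c').
      exact: compA.
    by rewrite cyl_map_j -compA e1; exact: compA.
  transitivity (cyl_map e3 e2 ∘ cyl_i (ct_i d') (ct_j c') ∘ ct_j d').
    exact: compA.
  by rewrite cyl_map_i -compA e4; exact: compA.
Qed.

Lemma homotopic_precomp (A B C : Dt) (f g : hom B C) (k : hom A B) :
  homotopic f g -> homotopic (f ∘ k) (g ∘ k).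
Proof.
move=> [c [ac [H [e1 e2]]]].
have [c' ac' [K [e3 e4]]] := admissible_pullback k ac.
exists c'; split=> //; exists (H ∘ K).
by rewrite -!compA e3 e4 !compA e1 e2.
Qed.

Definition KCat : Category.
Proof.
refine (@MkCategory Dt (@hom Dt) homotopic (@idm Dt) (@comp Dt) _ _ _ _ _).
- move=> A B; split.
  + by move=> f; apply: heq_homotopic.
  + by move=> f g; apply: homotopic_sym.
  + by move=> f g h; apply: homotopic_trans.
- move=> A B C g g' f f' eg ef; apply: (@homotopic_trans _ _ _ (g' ∘ f)).
    exact: homotopic_precomp.
  exact: homotopic_postcomp.
- by move=> *; apply: heq_homotopic; apply: compA.
- by move=> *; apply: heq_homotopic; apply: comp1m.
- by move=> *; apply: heq_homotopic; apply: compm1.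
Defined.

Definition toK : Functor Dt KCat.
Proof.
refine (@MkFunctor Dt KCat (fun A => A) (fun A B f => f) _ _ _).
- by move=> A B f g; apply: heq_homotopic.
- by move=> A; apply: heq_homotopic.
- by move=> A B C g f; apply: heq_homotopic.
Defined.

Definition KE : MorClass KCat :=
  fun A B f => exists e : @hom Dt A B, sd_E e /\ @heq KCat A B f e.

Definition HoCat : Category := Loc (@sd_E D).

End Homotopy.

(* Main.v *)
Set Warnings "-notation-overridden".
From Stdlib Require Import Setoid Morphisms.
From mathcomp Require Import all_boot.
Require Import Defs.

(** Everything rests on one fact: if [f : A -> B] is an equivalence, then for every
    [g : A -> C] the map [j : C -> cyl(f, g)] is an equivalence ([cyl_j_E]).

    Why this holds.  For [f : X -> Y] and [g : X -> Z] simplicial with [s Z] acyclic,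
    [s f] is an equivalence iff [s Cyl(f, g)] is acyclic ([simple_E_cylinder]).
    Indeed [Cyl(f, g)] is the diagonal of the bisimplicial object whose level [n] is
    the simplicial object [Y ⊔ ∐^n X ⊔ Z]; by [μ] its simple is isomorphic in
    [Ho D] to [s (n ↦ s (Y ⊔ ∐^n X ⊔ Z))], and since [s] preserves finite
    coproducts up to equivalence this is [s Cyl(s f × Δ, s g × Δ)].  When [s Z] is
    acyclic, replacing it by the final object turns the last cylinder into the
    cone of [s f], to which the cone axiom applies.  Acyclicity can be followed
    along these zigzags because the final object of [D] remains final in [Ho D].

    Now let [J : Z -> Cyl(f, g)].  By the criterion, [s J] is an equivalence iff
    [s Cyl(J, Z -> 1)] is acyclic.  Cylinders are associative: [Cyl(J, q)] is
    isomorphic to [Cyl(f, I g)], where [I : Z -> Cyl(Id, q)] ([univ_cyl_assoc]).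
    For [q : Z -> 1] the object [s Cyl(Id, q)] is acyclic, because [s Id] is an
    equivalence, so the criterion applies again, to [f] this time: [s J] is an
    equivalence iff [s f] is one ([Cyl_J_E]).

    Consequences.  By induction the projection of every admissible cylinder is an
    equivalence, hence homotopic maps are equal in [Ho D] ([homotopic_Ho]); as
    equivalences are saturated, the equivalences modulo homotopy are just the
    equivalences ([KE_E]), and the localization of [K D] is that of [D].
    The Ore square of a pair [e, u] with [e] an equivalence is
    [C -> cyl(e, u) <- B], which commutes up to homotopy ([cyl_homotopic]).  The
    cancellation condition comes from the same square built on a homotopy pushout
    ([homotopic_left_cancel]). *)

Set Implicit Arguments.
Unset Strict Implicit.
Unset Printing Implicit Defensive.

Local Open Scope cat_scope.

(** * Isomorphisms, initial objects and finite coproducts *)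

Section Isomorphisms.
Context (C : Category).

Lemma iso_id (x : C) : is_iso (idm x).
Proof. by exists (idm x); rewrite comp1m. Qed.

Lemma iso_heq (x y : C) (f g : hom x y) : f ≈ g -> is_iso f -> is_iso g.
Proof. by move=> e [h [hf fh]]; exists h; rewrite -e. Qed.

Lemma iso_comp (x y z : C) (g : hom y z) (f : hom x y) :
  is_iso g -> is_iso f -> is_iso (g ∘ f).
Proof.
move=> [g' [g'g gg']] [f' [f'f ff']]; exists (f' ∘ g'); split.
  by rewrite -compA (compA g') g'g comp1m.
by rewrite -compA (compA f) ff' comp1m.
Qed.

Lemma iso_cancel_l (x y z : C) (g : hom y z) (f : hom x y) :
  is_iso g -> is_iso (g ∘ f) -> is_iso f.
Proof.
move=> [g' [g'g gg']] gf; apply: (@iso_heq _ _ (g' ∘ (g ∘ f))).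
  by rewrite compA g'g comp1m.
by apply: iso_comp => //; exists g.
Qed.

Lemma iso_cancel_r (x y z : C) (g : hom y z) (f : hom x y) :
  is_iso f -> is_iso (g ∘ f) -> is_iso g.
Proof.
move=> [f' [f'f ff']] gf; apply: (@iso_heq _ _ ((g ∘ f) ∘ f')).
  by rewrite -compA ff' compm1.
by apply: iso_comp => //; exists f.
Qed.

Lemma fmap_iso (B : Category) (F : Functor C B) (x y : C) (f : hom x y) :
  is_iso f -> is_iso (fmap F f).
Proof. by move=> [g [gf fg]]; exists (fmap F g); rewrite -!fmapM gf fg !fmap1. Qed.

End Isomorphisms.

Definition evF (J C : Category) (x : J) : Functor (Fun J C) C.
Proof.
refine (@MkFunctor (Fun J C) C (fun X => X x) (fun X Y a => ntc a x) _ _ _) => //.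
Defined.

Definition initial (C : Category) (x : C) : Prop :=
  forall y : C, inhabited (hom x y) /\ forall u v : hom x y, u ≈ v.

Lemma initial_iso (C : Category) (x y : C) (f : hom x y) :
  initial x -> initial y -> is_iso f.
Proof.
move=> ix iy; have [[g] _] := iy x.
by exists g; split; [apply: (ix x).2 | apply: (iy y).2].
Qed.

Lemma empty_coproduct_initial (C : Category) (I : finType) (F : I -> C)
  (P : Coproduct F) : #|I| = 0 -> initial (cop_ob P).
Proof.
move=> I0 y; have no (i : I) : False by move: (fintype0 i).
split; first by split; apply: (cop_desc P) => i; case: (no i).
by move=> u v; apply: cop_uniq => i; case: (no i).
Qed.

(** The coproduct of a family [F] is [F i0 ⊔ ∐_{i ≠ i0} F i]; it reduces
    statements on finite coproducts to the binary ones. *)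
Section SplitCoproduct.
Context (C : Category) (I : finType) (F : I -> C) (i0 : I).
Context (P : Coproduct F).
Context (P' : Coproduct (fun j : {i : I | i != i0} => F (val j))).
Context (B : BinCoproduct (F i0) (cop_ob P')).

Definition split_map : hom (bc_ob B) (cop_ob P) :=
  copair B (cop_in P i0) (cop_desc P' (fun j => cop_in P (val j))).

Lemma split_map1 : split_map ∘ in1 B ≈ cop_in P i0.
Proof. exact: copair1. Qed.

Lemma split_map2 j : split_map ∘ (in2 B ∘ cop_in P' j) ≈ cop_in P (val j).
Proof. by rewrite compA copair2 cop_descE. Qed.

Lemma split_map_iso : is_iso split_map.
Proof.
(* The inverse sends the summand of index [i] to [F i0] or to [P'], according to
   whether [i] is [i0]; its values are given with their characterization. *)
have H (i : I) : {h : hom (F i) (bc_ob B) |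
    (forall e : i0 = i,
      h ≈ match e in _ = i return hom (F i) _ with erefl => in1 B end) /\
    (forall j (e : val j = i),
      h ≈ match e in _ = i return hom (F i) _ with
          erefl => in2 B ∘ cop_in P' j end)}.
  case: (eqVneq i i0) => [->|ne].
    exists (in1 B); split=> [e|j e]; first by rewrite (eq_irrelevance e erefl).
    by case/eqP: (valP j).
  exists (in2 B ∘ cop_in P' (exist _ i ne)); split=> [e|j e].
    by case/eqP: (ne).
  have ej : exist _ i ne = j by apply: val_inj.
  by case: _ / ej e => e; rewrite (eq_irrelevance e erefl).
pose inv := cop_desc P (fun i => sval (H i)).
have inv0 : inv ∘ cop_in P i0 ≈ in1 B.
  by rewrite cop_descE; apply: (svalP (H i0)).1 erefl.
have invj j : inv ∘ cop_in P (val j) ≈ in2 B ∘ cop_in P' j.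
  by rewrite cop_descE; apply: (svalP (H (val j))).2 j erefl.
exists inv; split.
  apply: bc_uniq; first by rewrite -compA split_map1 comp1m.
  by apply: cop_uniq => j; rewrite -!compA split_map2 comp1m.
apply: cop_uniq => i; rewrite comp1m -compA.
have [->|ne] := eqVneq i i0; first by rewrite inv0 split_map1.
pose j : {i : I | i != i0} := exist _ i ne.
transitivity (split_map ∘ (in2 B ∘ cop_in P' j)); last exact: (split_map2 j).
by apply: comp_heq => //; exact: (invj j).
Qed.

End SplitCoproduct.

(** * Equivalences and acyclic objects *)

Section Equivalences.
Context (D : SimplicialDescentCategory).
Notation Dt := (sd_cat D).
Notation E := (@sd_E D).
Notation cop := (@sd_cop D).

Lemma E_heq (x y : Dt) (f g : hom x y) : f ≈ g -> E f -> E g.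
Proof.
by move=> e /sd_saturated Ef; apply/sd_saturated; apply: iso_heq Ef; rewrite e.
Qed.

Lemma E_iso (x y : Dt) (f : hom x y) : is_iso f -> E f.
Proof. by move=> If; apply/sd_saturated; apply: fmap_iso. Qed.

Lemma E_id (x : Dt) : E (idm x).
Proof. by apply: E_iso; apply: iso_id. Qed.

Lemma E_comp (x y z : Dt) (g : hom y z) (f : hom x y) : E g -> E f -> E (g ∘ f).
Proof.
move=> /sd_saturated Eg /sd_saturated Ef; apply/sd_saturated.
by apply: iso_heq (iso_comp Eg Ef); rewrite fmapM.
Qed.

Lemma E_cancel_l (x y z : Dt) (g : hom y z) (f : hom x y) :
  E g -> E (g ∘ f) -> E f.
Proof.
move=> /sd_saturated Eg /sd_saturated Egf; apply/sd_saturated.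
by apply: iso_cancel_l Eg _; apply: iso_heq Egf; rewrite fmapM.
Qed.

Lemma E_cancel_r (x y z : Dt) (g : hom y z) (f : hom x y) :
  E f -> E (g ∘ f) -> E g.
Proof.
move=> /sd_saturated Ef /sd_saturated Egf; apply/sd_saturated.
by apply: iso_cancel_r Ef _; apply: iso_heq Egf; rewrite fmapM.
Qed.

Lemma rho_E (A : Dt) : E (sd_rho D A).
Proof.
apply: E_cancel_l (sd_lambda_E A) _.
by apply: E_heq (E_id A); symmetry; exact: sd_lambda_rho.
Qed.

Notation acy := (acyclic E (sd_ter D)).

(** The final object of [D] is final in [Ho D]: a zigzag into it can be pushed
    through its arrows one at a time. *)
Lemma ter_zig (x y : Dt) (p : zig E x y) :
  zeq (zcomp (zfwd E (ter_map (sd_ter D) y)) p) (zfwd E (ter_map (sd_ter D) x)).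
Proof.
elim: p => {x y} [x y f|x y f Ef|x y z q eq p ep].
- apply: zeq_trans (zeq_sym (zeq_comp _ _ _)) _.
  by apply: zeq_fwd; apply: ter_uniq.
- have e : zeq (zfwd E (ter_map (sd_ter D) x))
               (zcomp (zfwd E (ter_map (sd_ter D) y)) (zfwd E f)).
    by apply: zeq_trans (zeq_comp _ _ _); apply: zeq_fwd; apply: ter_uniq.
  apply: zeq_trans (zeq_cong e (zeq_refl _)) _.
  apply: zeq_trans (zeq_sym (zeq_assoc _ _ _)) _.
  apply: zeq_trans (zeq_cong (zeq_refl _) (zeq_invr Ef)) _.
  exact: zeq_z1.
- apply: zeq_trans (zeq_assoc _ _ _) _.
  exact: zeq_trans (zeq_cong eq (zeq_refl _)) ep.
Qed.

(** Acyclicity only depends on the object of [Ho D]; this is what makes the mere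
    existence of the zigzag given by [μ] sufficient. *)
Lemma acyclic_iso (x y : Dt) (p : @hom (Loc E) x y) :
  is_iso p -> acy x <-> acy y.
Proof.
move=> Ip; rewrite /acyclic !sd_saturated; split=> H.
  by apply: iso_cancel_r Ip _; apply: iso_heq H; symmetry; apply: ter_zig.
by apply: iso_heq (iso_comp H Ip); apply: ter_zig.
Qed.

Lemma acyclic_E (x y : Dt) (f : hom x y) : E f -> acy x <-> acy y.
Proof. by move=> /sd_saturated; apply: acyclic_iso. Qed.

(** * Functors preserving finite coproducts up to equivalence *)

Section PreservesCoproducts.
Context (C : Category) (copC : FinCoproducts C) (S : Functor C Dt).

(** The initial object enters through some initial object of [C], so that the one
    for which the comparison map is easiest to see can be used. *)
Record preserves_cop : Prop := PreservesCop {
  pres_bin : forall X Y : C,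
    E (copair (bcop cop (S X) (S Y)) (fmap S (in1 (bcop copC X Y)))
         (fmap S (in2 (bcop copC X Y))));
  pres_init : exists (x : C) (y : Dt) (e : hom y (S x)),
    [/\ initial x, initial y & E e]
}.

Context (SP : preserves_cop).

(** The two conditions of [preserves_cop] suffice for all finite coproducts, by
    induction on the number of summands.  Allowing equivalences [f i] on the
    summands covers at once the closure of [E] under finite coproducts ([S] the
    identity) and the comparison maps of [S] ([f i] identities). *)
Lemma pres_coproduct (I : finType) (F : I -> C) (P : Coproduct F) (G : I -> Dt)
  (Q : Coproduct G) (f : forall i, hom (G i) (S (F i)))
  (e : hom (cop_ob Q) (S (cop_ob P))) :
  (forall i, E (f i)) ->
  (forall i, e ∘ cop_in Q i ≈ fmap S (cop_in P i) ∘ f i) -> E e.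
Proof.
have [n] := ubnP #|I|; elim: n I F P G Q f e => // n IH I F P G Q f e In Ef ef.
have [i0 _|I0] := pickP (xpredT : pred I); last first.
  have cI : #|I| = 0 by apply: eq_card0.
  have iP := empty_coproduct_initial P cI.
  have iQ := empty_coproduct_initial Q cI.
  have [x [y [d [ix iy Ed]]]] := pres_init SP.
  have [[a] _] := ix (cop_ob P).
  have [[b] _] := iQ y.
  apply: (@E_heq _ _ (fmap S a ∘ d ∘ b)); first exact: (iQ _).2.
  apply: E_comp; last by apply: E_iso; apply: initial_iso.
  by apply: E_comp Ed; apply: E_iso; apply: fmap_iso; apply: initial_iso.
pose J : finType := {i : I | i != i0}.
pose P' := @copC J (fun j => F (val j)).
pose Q' := @sd_cop D J (fun j => G (val j)).
pose e' := cop_desc Q' (fun j => fmap S (cop_in P' j) ∘ f (val j)).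
have Ee' : E e'.
  apply: (IH _ _ P' _ Q' (fun j => f (val j)) e') => //; last first.
    by move=> j; rewrite cop_descE.
  move: In; rewrite ltnS; apply: leq_trans; rewrite card_sig.
  apply: proper_card; apply/properP; split; first exact/subsetP.
  by exists i0 => //; rewrite inE eqxx.
pose BC := bcop copC (F i0) (cop_ob P').
pose BS := bcop cop (S (F i0)) (S (cop_ob P')).
pose BD := bcop cop (G i0) (cop_ob Q').
apply: (@E_cancel_r _ _ _ _ (split_map Q BD)).
  by apply: E_iso; apply: split_map_iso.
apply: (@E_heq _ _ (fmap S (split_map P BC) ∘
  (copair BS (fmap S (in1 BC)) (fmap S (in2 BC)) ∘ bc_map BD BS (f i0) e'))).
  apply: bc_uniq.
    rewrite -!compA split_map1 ef /bc_map copair1 (compA _ _ (f i0)) copair1.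
    by rewrite compA -fmapM split_map1.
  apply: cop_uniq => j.
  rewrite -!compA split_map2 ef /bc_map (compA _ _ (cop_in _ _)) copair2.
  rewrite -(compA _ e') cop_descE (compA _ (in2 BS)) copair2.
  by rewrite !compA -!fmapM -compA split_map2.
apply: E_comp; first by apply: E_iso; apply: fmap_iso; apply: split_map_iso.
by apply: E_comp; [apply: (pres_bin SP) | apply: sd_E_cop].
Qed.

End PreservesCoproducts.

Definition zero : Dt := cop_ob (@sd_cop D void (fun v => match v with end)).

Lemma initial0 : initial zero.
Proof. by apply: empty_coproduct_initial; rewrite card_void. Qed.

Lemma idF_preserves_cop : preserves_cop cop (idF Dt).
Proof.
split=> [X Y|].
  apply: E_iso; apply: iso_heq (iso_id _).
  by apply: bc_uniq; rewrite comp1m ?copair1 ?copair2.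
exists _, _, (idm zero); split; [exact: initial0 | exact: initial0 |].
exact: E_id.
Qed.

Lemma initial_fun (J C : Category) (X : Functor J C) :
  (forall T (x : J), {u : hom (X x) T & forall v, u ≈ v}) ->
  initial (X : Fun J C).
Proof.
move=> iX T; split.
  split; refine (@MkNatTrans J C X T (fun x => projT1 (iX _ x)) _) => x y f.
  by transitivity (projT1 (iX (T y) x)); [symmetry|]; exact: (projT2 (iX (T y) x) _).
move=> u v x; transitivity (projT1 (iX (T x) x)); last exact: (projT2 (iX (T x) x) _).
by symmetry; exact: (projT2 (iX (T x) x) _).
Qed.

Lemma initial_const (J : Category) :
  initial (constF J zero : Fun J Dt).
Proof.
apply: initial_fun => T x.
by exists (cop_desc _ (fun v : void => match v with end)) => v; apply: cop_uniq; case.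
Qed.

Lemma evF_preserves_cop (n : op Delta) :
  preserves_cop (@Fun_coproducts (op Delta) Dt cop) (@evF (op Delta) Dt n).
Proof.
split=> [X Y|].
  apply: E_iso.
  exists (copair (scop_at cop X Y n) (in1 (bcop cop (fob X n) (fob Y n)))
     (in2 (bcop cop (fob X n) (fob Y n)))); split.
    apply: bc_uniq; rewrite comp1m -compA.
      by rewrite copair1; exact: (copair1 (scop_at cop X Y n)).
    by rewrite copair2; exact: (copair2 (scop_at cop X Y n)).
  apply: (bc_uniq (b:=scop_at cop X Y n)); rewrite comp1m -compA.
    by rewrite (copair1 (scop_at cop X Y n)) copair1.
  by rewrite (copair2 (scop_at cop X Y n)) copair2.
exists (constF (op Delta) zero), _, (idm zero); split; [exact: initial_const | exact: initial0 |].
exact: E_id.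
Qed.

(** The binary case is an axiom.  As [0 × Δ] is initial, the empty case follows
    from the equivalence [λ : s(0 × Δ) -> 0]. *)
Lemma s_preserves_cop : preserves_cop (@Fun_coproducts (op Delta) Dt cop) (sd_s D).
Proof.
split; first exact: sd_s_cop.
exists _, _, (sd_rho D zero); split; [exact: initial_const | exact: initial0 |].
exact: rho_E.
Qed.

End Equivalences.

(** * The universal property of double cylinders *)

Lemma ntcM (J C : Category) (F G H : Fun J C) (b : hom G H) (a : hom F G) (n : J) :
  ntc (b ∘ a) n = ntc b n ∘ ntc a n.
Proof. by []. Qed.

#[local] Instance ntc_Proper (J C : Category) (F G : Fun J C) :
  Proper (@heq (Fun J C) F G ==> forall_relation (fun n => @heq C (fob F n) (fob G n)))
    (@ntc J C F G).
Proof. by move=> a b e n; apply: e. Qed.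

Section CylinderCocones.
Context (C : Category) (X Y Z : Simp C) (f : hom X Y) (g : hom X Z).

(** A map out of [Cyl(f, g)], without mention of the object representing it: the
    component at [k : Δ[1]_n] is the restriction to the copy of [X_n] indexed by
    [k].  In this form diagonals and levelwise images of cylinders receive maps
    from cylinders without any identification of coproducts. *)
Record CylCocone (W : Simp C) := MkCylCocone {
  cc_I : hom Y W;
  cc_J : hom Z W;
  cc_x : forall n : op Delta, dhom n 1 -> hom (fob X n) (fob W n);
  cc_nat : forall (n m : op Delta) (t : @hom (op Delta) n m) (k : dhom n 1),
    fmap W t ∘ cc_x k ≈ cc_x (dcomp k t : dhom m 1) ∘ fmap X t;
  cc_0 : forall n : op Delta, cc_x (vertex ord0 n) ≈ ntc cc_I n ∘ ntc f n;
  cc_1 : forall n : op Delta, cc_x (vertex ord_max n) ≈ ntc cc_J n ∘ ntc g n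
}.

(** The proof of associativity manipulates four nested cylinders; it only uses
    their universal properties. *)
Record UnivCyl := MkUnivCyl {
  uc_ob : Simp C;
  uc_cocone :> CylCocone uc_ob;
  uc_desc : forall W : Simp C, CylCocone W -> hom uc_ob W;
  uc_descI : forall (W : Simp C) (c : CylCocone W), uc_desc c ∘ cc_I uc_cocone ≈ cc_I c;
  uc_descJ : forall (W : Simp C) (c : CylCocone W), uc_desc c ∘ cc_J uc_cocone ≈ cc_J c;
  uc_descx : forall (W : Simp C) (c : CylCocone W) (n : op Delta) (k : dhom n 1),
    ntc (uc_desc c) n ∘ cc_x uc_cocone k ≈ cc_x c k;
  uc_ext : forall (W : Simp C) (u v : hom uc_ob W),
    u ∘ cc_I uc_cocone ≈ v ∘ cc_I uc_cocone ->
    u ∘ cc_J uc_cocone ≈ v ∘ cc_J uc_cocone ->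
    (forall (n : op Delta) (k : dhom n 1),
      ntc u n ∘ cc_x uc_cocone k ≈ ntc v n ∘ cc_x uc_cocone k) -> u ≈ v
}.

End CylinderCocones.

Section CylinderCoproduct.
Context (C : Category) (cop : FinCoproducts C).
Context (X Y Z : Simp C) (f : hom X Y) (g : hom X Z).

Let I := Cyl_I cop f g.
Let J := Cyl_J cop f g.

Definition Cyl_x (n : op Delta) (k : dhom n 1) :
  hom (fob X n) (fob (Cyl cop f g) n) :=
  ntc (po_inl (Cyl_pushout cop f g)) n ∘ cop_in (box_cop cop (std 1) X n) k.

Lemma Cyl_x_nat (n m : op Delta) (t : @hom (op Delta) n m) (k : dhom n 1) :
  fmap (Cyl cop f g) t ∘ Cyl_x k ≈ Cyl_x (dcomp k t) ∘ fmap X t.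
Proof.
rewrite /Cyl_x compA -(nt_nat (po_inl (Cyl_pushout cop f g)) t) -!compA.
by apply: comp_heq => //=; rewrite cop_descE.
Qed.

Lemma Cyl_x0 (n : op Delta) : Cyl_x (vertex ord0 n) ≈ ntc I n ∘ ntc f n.
Proof.
rewrite /Cyl_x -(dmapE cop ord0 X n).
exact: (dcyl1 (Cyl_pushout cop f g) n).
Qed.

Lemma Cyl_x1 (n : op Delta) : Cyl_x (vertex ord_max n) ≈ ntc J n ∘ ntc g n.
Proof.
rewrite /Cyl_x -(dmapE cop ord_max X n).
exact: (dcyl2 (Cyl_pushout cop f g) n).
Qed.

Definition inner (n : op Delta) : finType :=
  {k : dhom n 1 | (k != vertex ord0 n) && (k != vertex ord_max n)}.

Definition cyl_summand (n : op Delta) (i : option (option (inner n))) : C :=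
  match i with
  | None => fob Y n
  | Some None => fob Z n
  | Some (Some _) => fob X n
  end.

Definition cyl_incl (n : op Delta) (i : option (option (inner n))) :
  hom (cyl_summand i) (fob (Cyl cop f g) n) :=
  match i with
  | None => ntc I n
  | Some None => ntc J n
  | Some (Some k) => Cyl_x (val k)
  end.

Section Coproduct.
Context (n : op Delta).

Let M := @cop (inner n) (fun=> fob X n).
Let YM := bcop cop (fob Y n) (cop_ob M).
Let YMZ := bcop cop (bc_ob YM) (fob Z n).

Lemma cyl_incl_Y : @cyl_incl n None ≈ in1 YMZ ∘ in1 YM.
Proof. exact: (copair1 (scop_at cop Y Z n)). Qed.

Lemma cyl_incl_Z : @cyl_incl n (Some None) ≈ in2 YMZ.
Proof. exact: (copair2 (scop_at cop Y Z n)). Qed.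

Lemma cyl_incl_X (k : inner n) :
  @cyl_incl n (Some (Some k)) ≈ in1 YMZ ∘ in2 YM ∘ cop_in M k.
Proof. by rewrite /= /Cyl_x /= cop_descE tp_comp_m. Qed.

(** The decomposition [Cyl(f, g)_n = Y_n ⊔ Z_n ⊔ ∐ X_n], with the inclusions
    induced by [Cyl_I], [Cyl_J] and [Cyl_x]; the last coproduct is over the
    non-constant elements of [Δ[1]_n]. *)
Definition Cyl_coproduct : Coproduct (@cyl_summand n).
Proof.
refine (@MkCoproduct C _ (@cyl_summand n) (fob (Cyl cop f g) n) (@cyl_incl n)
  (fun T h => copair YMZ
     (copair YM (h None) (cop_desc M (fun k => h (Some (Some k)))))
     (h (Some None))) _ _).
- move=> T h [[k|]|].
  + rewrite cyl_incl_X !compA copair1 copair2.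
    exact: (cop_descE M (fun k => h (Some (Some k))) k).
  + by rewrite cyl_incl_Z copair2.
  + by rewrite cyl_incl_Y compA !copair1.
- move=> T u v e; apply: (bc_uniq (b := YMZ)); first apply: (bc_uniq (b := YM)).
  + by have := e None; rewrite cyl_incl_Y !compA.
  + apply: cop_uniq => k.
    by have := e (Some (Some k)); rewrite cyl_incl_X !compA.
  + by have := e (Some None); rewrite cyl_incl_Z.
Defined.

End Coproduct.

Lemma Cyl_ext (n : op Delta) (T : C) (u v : hom (fob (Cyl cop f g) n) T) :
  u ∘ ntc I n ≈ v ∘ ntc I n -> u ∘ ntc J n ≈ v ∘ ntc J n ->
  (forall k : dhom n 1, u ∘ Cyl_x k ≈ v ∘ Cyl_x k) -> u ≈ v.
Proof.
move=> e1 e2 e3.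
refine (@cop_uniq _ _ _ (Cyl_coproduct n) T u v _) => -[[k|]|];
  [exact: (e3 (val k)) | exact: e2 | exact: e1].
Qed.

Section Descent.
Context (W : Simp C) (c : CylCocone f g W).

Definition box_desc : hom (box cop (std 1) X) W.
Proof.
refine (@MkNatTrans (op Delta) C (box cop (std 1) X) W
  (fun n => cop_desc (box_cop cop (std 1) X n) (@cc_x _ _ _ _ _ _ _ c n)) _).
move=> n m t; apply: cop_uniq => k /=.
by rewrite -!compA !cop_descE compA cop_descE cc_nat.
Defined.

Lemma box_desc_vertex (i : 'I_2) (n : op Delta) :
  ntc box_desc n ∘ dmap cop i X n ≈ cc_x c (vertex i n).
Proof. by rewrite dmapE; apply: cop_descE. Qed.

Lemma box_desc_square :
  box_desc ∘ copair (scop cop X X) (d0 cop X : hom X _) (d1 cop X) ≈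
  copair (scop cop Y Z) (cc_I c) (cc_J c) ∘ bc_map (scop cop X X) (scop cop Y Z) f g.
Proof.
apply: dcyl_eq.
  rewrite copair1 => n.
  by transitivity (cc_x c (vertex ord0 n)); [apply: box_desc_vertex | apply: cc_0].
rewrite copair2 => n.
by transitivity (cc_x c (vertex ord_max n)); [apply: box_desc_vertex | apply: cc_1].
Qed.

Definition Cyl_desc : hom (Cyl cop f g) W :=
  po_desc (Cyl_pushout cop f g) box_desc_square.

Lemma Cyl_desc_I : Cyl_desc ∘ I ≈ cc_I c.
Proof. by rewrite /Cyl_desc /I /Cyl_I compA po_descr copair1. Qed.

Lemma Cyl_desc_J : Cyl_desc ∘ J ≈ cc_J c.
Proof. by rewrite /Cyl_desc /J /Cyl_J compA po_descr copair2. Qed.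

Lemma Cyl_desc_x (n : op Delta) (k : dhom n 1) :
  ntc Cyl_desc n ∘ Cyl_x k ≈ cc_x c k.
Proof.
have e : Cyl_desc ∘ po_inl (Cyl_pushout cop f g) ≈ box_desc by apply: po_descl.
rewrite /Cyl_x compA.
transitivity (ntc box_desc n ∘ cop_in (box_cop cop (std 1) X n) k).
  by apply: comp_heq => //; exact: (e n).
exact: cop_descE.
Qed.

End Descent.

Definition Cyl_cocone : CylCocone f g (Cyl cop f g) :=
  MkCylCocone Cyl_x_nat Cyl_x0 Cyl_x1.

Definition Cyl_univ : UnivCyl f g.
Proof.
refine (@MkUnivCyl C X Y Z f g (Cyl cop f g) Cyl_cocone Cyl_desc
  Cyl_desc_I Cyl_desc_J Cyl_desc_x _).
move=> W u v e1 e2 e3 n.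
by apply: Cyl_ext; [exact: e1 | exact: e2 | exact: e3].
Defined.

End CylinderCoproduct.

Lemma Cyl_map_x (C : Category) (cop : FinCoproducts C)
  (X Y Z X' Y' Z' : Simp C)
  (f : hom X Y) (g : hom X Z) (f' : hom X' Y') (g' : hom X' Z')
  (y : hom Y Y') (x : hom X X') (z : hom Z Z')
  (yf : y ∘ f ≈ f' ∘ x) (zg : z ∘ g ≈ g' ∘ x) (n : op Delta) (k : dhom n 1) :
  ntc (Cyl_map cop yf zg) n ∘ Cyl_x cop f g k ≈ Cyl_x cop f' g' k ∘ ntc x n.
Proof.
have e : Cyl_map cop yf zg ∘ po_inl (Cyl_pushout cop f g) ≈
  po_inl (Cyl_pushout cop f' g') ∘ box_map cop (idN (std 1)) x.
  by apply: po_descl.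
rewrite /Cyl_x compA.
transitivity (ntc (po_inl (Cyl_pushout cop f' g')) n ∘
  ntc (box_map cop (idN (std 1)) x) n ∘ cop_in (box_cop cop (std 1) X n) k).
  by apply: comp_heq => //; exact: (e n).
by rewrite -!compA; apply: comp_heq => //=; rewrite cop_descE.
Qed.

(** * Associativity of double cylinders *)

Section Associativity.
Context (C : Category) (X Y Z V : Simp C).
Context (f : hom X Y) (g : hom X Z) (q : hom Z V).
Context (P : UnivCyl f g) (N : UnivCyl (idm Z) q).
Context (L : UnivCyl (cc_J P) q) (R : UnivCyl f (cc_I N ∘ g)).

Lemma comp_cc_nat (W W' : Simp C) (X' Y' Z' : Simp C) (f' : hom X' Y')
  (g' : hom X' Z') (c : CylCocone f' g' W) (h : hom W W')
  (n m : op Delta) (t : @hom (op Delta) n m) (k : dhom n 1) :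
  fmap W' t ∘ (ntc h n ∘ cc_x c k) ≈
  ntc h m ∘ cc_x c (dcomp k t : dhom m 1) ∘ fmap X' t.
Proof. by rewrite compA -(nt_nat h t) -!compA cc_nat. Qed.

(** [P = Cyl(f, g)] and [N = Cyl(Id, q)]; the objects [L = Cyl(J_Z, q)] and
    [R = Cyl(f, I_Z g)] both consist of [P] and [N] glued along [Z].  Each of them
    therefore contains [P] and [N], and the comparison maps match these parts. *)
Definition cocone_P_R : CylCocone f g (uc_ob R).
Proof.
refine (@MkCylCocone C X Y Z f g (uc_ob R) (cc_I R) (cc_J R ∘ cc_I N)
  (@cc_x _ _ _ _ _ _ _ R) (@cc_nat _ _ _ _ _ _ _ R) (cc_0 R) _).
by move=> n; rewrite cc_1 !ntcM compA.
Defined.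

Definition cocone_L_R : CylCocone (cc_J P) q (uc_ob R).
Proof.
refine (@MkCylCocone C _ _ _ _ _ (uc_ob R) (uc_desc P cocone_P_R) (cc_J R ∘ cc_J N)
  (fun n k => ntc (cc_J R) n ∘ cc_x N k) _ _ _).
- by move=> n m t k; apply: comp_cc_nat.
- move=> n; rewrite cc_0 -!ntcM compm1; symmetry; exact: (uc_descJ P cocone_P_R n).
- by move=> n; rewrite cc_1 ntcM compA.
Defined.

Definition cocone_N_L : CylCocone (idm Z) q (uc_ob L).
Proof.
refine (@MkCylCocone C _ _ _ _ _ (uc_ob L) (cc_I L ∘ cc_J P) (cc_J L)
  (@cc_x _ _ _ _ _ _ _ L) (@cc_nat _ _ _ _ _ _ _ L) _ (cc_1 L)).
by move=> n; rewrite cc_0 -!ntcM compm1.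
Defined.

Definition cocone_R_L : CylCocone f (cc_I N ∘ g) (uc_ob L).
Proof.
refine (@MkCylCocone C _ _ _ _ _ (uc_ob L) (cc_I L ∘ cc_I P) (uc_desc N cocone_N_L)
  (fun n k => ntc (cc_I L) n ∘ cc_x P k) _ _ _).
- by move=> n m t k; apply: comp_cc_nat.
- by move=> n; rewrite cc_0 ntcM compA.
- move=> n; rewrite cc_1 -!ntcM.
  have e : uc_desc N cocone_N_L ∘ (cc_I N ∘ g) ≈ cc_I L ∘ (cc_J P ∘ g).
    by rewrite compA uc_descI compA.
  by symmetry; exact: (e n).
Defined.

Let lr := uc_desc L cocone_L_R.
Let rl := uc_desc R cocone_R_L.

Lemma rl_P : rl ∘ uc_desc P cocone_P_R ≈ cc_I L.
Proof.
apply: uc_ext => [||n k]; rewrite ?ntcM -compA.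
- by rewrite uc_descI; exact: uc_descI.
- rewrite uc_descJ; transitivity (rl ∘ cc_J R ∘ cc_I N); first exact: compA.
  by rewrite uc_descJ; exact: uc_descI.
- by rewrite uc_descx; exact: uc_descx.
Qed.

Lemma lr_N : lr ∘ uc_desc N cocone_N_L ≈ cc_J R.
Proof.
apply: uc_ext => [||n k]; rewrite ?ntcM -compA.
- rewrite uc_descI; transitivity (lr ∘ cc_I L ∘ cc_J P); first exact: compA.
  by rewrite uc_descI; exact: uc_descJ.
- by rewrite uc_descJ; exact: uc_descJ.
- by rewrite uc_descx; exact: uc_descx.
Qed.

Lemma univ_cyl_assoc : exists h : hom (uc_ob L) (uc_ob R), is_iso h.
Proof.
exists lr, rl; split; apply: uc_ext => [||n k]; rewrite ?ntcM comp1m -compA.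
- by rewrite uc_descI; exact: rl_P.
- rewrite uc_descJ; transitivity (rl ∘ cc_J R ∘ cc_J N); first exact: compA.
  by rewrite uc_descJ; exact: uc_descJ.
- rewrite uc_descx; transitivity (ntc (rl ∘ cc_J R) n ∘ cc_x N k).
    by rewrite ntcM; exact: compA.
  by rewrite uc_descJ; exact: uc_descx.
- rewrite uc_descI; transitivity (lr ∘ cc_I L ∘ cc_I P); first exact: compA.
  by rewrite uc_descI; exact: uc_descI.
- by rewrite uc_descJ; exact: lr_N.
- rewrite uc_descx; transitivity (ntc (lr ∘ cc_I L) n ∘ cc_x P k).
    by rewrite ntcM; exact: compA.
  by rewrite uc_descI; exact: uc_descx.
Qed.

End Associativity.

(** * The simple of a double cylinder *)

Section BisimplicialCocones.
Context (C : Category) (X Y Z : Simp C) (f : hom X Y) (g : hom X Z).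
Context (B : Bisimp C).
Context (c : CylCocone (fmap (SConst (Simp C)) f) (fmap (SConst (Simp C)) g) B).

(** A cocone under constant bisimplicial objects, [(SConst X)_(n,m) = X_m], gives
    one under [X], [Y], [Z] on the diagonal: in degree [n] take the component [n]
    of the map indexed by [k : Δ[1]_n]. *)
Definition diag_cocone : CylCocone f g (fob (Diag C) B).
Proof.
refine (@MkCylCocone C X Y Z f g (fob (Diag C) B)
  (fmap (Diag C) (cc_I c) ∘ diag_leftconst Y)
  (fmap (Diag C) (cc_J c) ∘ diag_leftconst Z)
  (fun n k => ntc (cc_x c k) n) _ _ _).
- move=> n m t k.
  have e := cc_nat c t k m.
  transitivity (ntc (fmap B t) m ∘ (fmap (fob B n) t ∘ ntc (cc_x c k) n)).
    by symmetry; apply: compA.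
  rewrite -(nt_nat (cc_x c k) t) compA.
  apply: comp_heq => //.
  by transitivity (ntc (cc_x c (dcomp k t : dhom m 1)) m ∘ idm (fob X m)); [exact: e | exact: compm1].
- move=> n; transitivity (ntc (cc_I c) n n ∘ ntc f n); first exact: (cc_0 c n n).
  by apply: comp_heq => //; symmetry; exact: compm1.
- move=> n; transitivity (ntc (cc_J c) n n ∘ ntc g n); first exact: (cc_1 c n n).
  by apply: comp_heq => //; symmetry; exact: compm1.
Defined.

Context (D : Category) (s : Functor (Simp C) D).

Definition const_level (W : Simp C) (a : @hom (Bisimp C) (SConst (Simp C) W) B) :
  @hom (Simp D) (SConst D (s W)) (fob (Post (op Delta) s) B).
Proof.
refine (@MkNatTrans (op Delta) D (SConst D (s W)) (s ∘F B)
  (fun n => fmap s (ntc a n)) _).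
move=> n m t; rewrite compm1.
transitivity (fmap s (fmap B t ∘ ntc a n));
  last exact: (fmapM s (fmap B t) (ntc a n)).
refine (@fmap_heq _ _ s _ _ (ntc a m) (fmap B t ∘ ntc a n) _).
transitivity (ntc a m ∘ idm W); first by symmetry; apply: compm1.
exact: (nt_nat a t).
Defined.

(** Applying [s] to each level of a cocone on [B] gives one on [n ↦ s(B_n)]. *)
Definition level_cocone :
  CylCocone (fmap (SConst D) (fmap s f)) (fmap (SConst D) (fmap s g))
    (fob (Post (op Delta) s) B).
Proof.
refine (@MkCylCocone D (SConst D (s X)) (SConst D (s Y)) (SConst D (s Z)) _ _
  (fob (Post (op Delta) s) B)
  (const_level (cc_I c)) (const_level (cc_J c))
  (fun n k => fmap s (cc_x c k)) _ _ _).
- move=> n m t k; rewrite compm1.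
  transitivity (fmap s (fmap B t ∘ cc_x c k)).
    by symmetry; exact: (fmapM s (fmap B t) (cc_x c k)).
  refine (@fmap_heq _ _ s _ _ (fmap B t ∘ cc_x c k) (cc_x c (dcomp k t : dhom m 1)) _).
  transitivity (cc_x c (dcomp k t : dhom m 1) ∘ idm X); last exact: compm1.
  exact: (cc_nat c t k).
- move=> n; transitivity (fmap s (ntc (cc_I c) n ∘ f));
    last exact: (fmapM s (ntc (cc_I c) n) f).
  by refine (@fmap_heq _ _ s _ _ _ (ntc (cc_I c) n ∘ f) _); exact: (cc_0 c n).
- move=> n; transitivity (fmap s (ntc (cc_J c) n ∘ g));
    last exact: (fmapM s (ntc (cc_J c) n) g).
  by refine (@fmap_heq _ _ s _ _ _ (ntc (cc_J c) n ∘ g) _); exact: (cc_1 c n).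
Defined.

End BisimplicialCocones.

Section CylinderEquivalences.
Context (D : SimplicialDescentCategory).
Notation Dt := (sd_cat D).
Notation E := (@sd_E D).
Notation cop := (@sd_cop D).
Notation acy := (acyclic E (sd_ter D)).
Notation s := (sd_s D).

(** The functor [S] compares a cylinder in [C] with one in [D], degree by degree;
    it is used with [S] the identity, an evaluation [Simp D -> D] and [s]. *)
Lemma pres_cylinder (C : Category) (copC : FinCoproducts C) (S : Functor C Dt)
  (SP : preserves_cop copC S)
  (X Y Z : Simp C) (f : hom X Y) (g : hom X Z)
  (X' Y' Z' : Simp Dt) (f' : hom X' Y') (g' : hom X' Z') (n : op Delta)
  (y : hom (fob Y' n) (S (fob Y n))) (z : hom (fob Z' n) (S (fob Z n)))
  (x : hom (fob X' n) (S (fob X n)))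
  (e : hom (fob (Cyl cop f' g') n) (S (fob (Cyl copC f g) n))) :
  E y -> E z -> E x ->
  e ∘ ntc (Cyl_I cop f' g') n ≈ fmap S (ntc (Cyl_I copC f g) n) ∘ y ->
  e ∘ ntc (Cyl_J cop f' g') n ≈ fmap S (ntc (Cyl_J copC f g) n) ∘ z ->
  (forall k : dhom n 1, e ∘ Cyl_x cop f' g' k ≈ fmap S (Cyl_x copC f g k) ∘ x) ->
  E e.
Proof.
move=> Ey Ez Ex eI eJ ex.
refine (@pres_coproduct D C copC S SP _ _ (Cyl_coproduct copC f g n)
  _ (Cyl_coproduct cop f' g' n)
  (fun i => match i with
            | None => y
            | Some None => z
            | Some (Some _) => x
            end) e _ _).
- by case=> [[k|]|].
- by case=> [[k|]|]; [exact: ex | exact: eJ | exact: eI].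
Qed.

Lemma Cyl_map_E (X Y Z X' Y' Z' : Simp Dt)
  (f : hom X Y) (g : hom X Z) (f' : hom X' Y') (g' : hom X' Z')
  (y : hom Y Y') (x : hom X X') (z : hom Z Z')
  (yf : y ∘ f ≈ f' ∘ x) (zg : z ∘ g ≈ g' ∘ x) :
  (forall n, E (ntc y n)) -> (forall n, E (ntc x n)) -> (forall n, E (ntc z n)) ->
  E (fmap s (Cyl_map cop yf zg)).
Proof.
move=> Ey Ex Ez; apply: sd_exact => n.
apply: (pres_cylinder (idF_preserves_cop D) (Ey n) (Ez n) (Ex n)).
- exact: (Cyl_map_I cop yf zg n).
- exact: (Cyl_map_J cop yf zg n).
- by move=> k; exact: (Cyl_map_x cop yf zg k).
Qed.

Section SimpleCylinder.
Context (X Y Z : Simp Dt) (f : hom X Y) (g : hom X Z).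

Let scopp := @Fun_coproducts (op Delta) Dt cop.
(* The bisimplicial object [B_(n,m) = Y_m ⊔ ∐^n X_m ⊔ Z_m]. *)
Let B : Bisimp Dt :=
  Cyl scopp (fmap (SConst (Simp Dt)) f) (fmap (SConst (Simp Dt)) g).
Let c := Cyl_cocone scopp (fmap (SConst (Simp Dt)) f) (fmap (SConst (Simp Dt)) g).

(** [Cyl(f, g) -> D(B)] is an equivalence in each degree, because coproducts of
    simplicial objects are computed degreewise. *)
Lemma diag_comparison_E : E (fmap s (Cyl_desc cop (diag_cocone c))).
Proof.
apply: sd_exact => n.
refine (@pres_cylinder (Simp Dt) scopp (evF Dt n) (evF_preserves_cop D n)
  _ _ _ (fmap (SConst (Simp Dt)) f) (fmap (SConst (Simp Dt)) g) X Y Z f g n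
  (idm (fob Y n)) (idm (fob Z n)) (idm (fob X n))
  (ntc (Cyl_desc cop (diag_cocone c)) n) (E_id _) (E_id _) (E_id _) _ _ _).
- exact: (Cyl_desc_I cop (diag_cocone c) n).
- exact: (Cyl_desc_J cop (diag_cocone c) n).
- by move=> k; rewrite compm1; exact: (Cyl_desc_x cop (diag_cocone c) k).
Qed.

(** [Cyl(s f × Δ, s g × Δ) -> (n ↦ s(B_n))] is an equivalence in each degree,
    because [s] preserves coproducts up to equivalence. *)
Lemma level_comparison_E : E (fmap s (Cyl_desc cop (level_cocone c s))).
Proof.
apply: sd_exact => n.
refine (@pres_cylinder (Simp Dt) scopp s (s_preserves_cop D)
  _ _ _ (fmap (SConst (Simp Dt)) f) (fmap (SConst (Simp Dt)) g)
  (SConst Dt (s X)) (SConst Dt (s Y)) (SConst Dt (s Z)) _ _ n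
  (idm (s Y)) (idm (s Z)) (idm (s X))
  (ntc (Cyl_desc cop (level_cocone c s)) n) (E_id _) (E_id _) (E_id _) _ _ _).
- by rewrite compm1; exact: (Cyl_desc_I cop (level_cocone c s) n).
- by rewrite compm1; exact: (Cyl_desc_J cop (level_cocone c s) n).
- by move=> k; rewrite compm1; exact: (Cyl_desc_x cop (level_cocone c s) k).
Qed.

(** Evaluation at [W] preserves objectwise equivalences, so it sends the zigzag of
    functors [μ] to a zigzag of objects. *)
Lemma mu_at_iso (W : Bisimp Dt) :
  exists p : @hom (Loc E) (s (fob (Diag Dt) W)) (s (fob (Post (op Delta) s) W)),
    is_iso p.
Proof.
pose ev : Functor (Loc (@objwise (Bisimp Dt) Dt E)) (Loc E) :=
  @LocMap _ _ (@objwise (Bisimp Dt) Dt E) E (evF Dt W) (fun F G a Ea => Ea W).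
by exists (fmap ev (sd_mu D)); exact: (fmap_iso ev (sd_mu_iso D)).
Qed.

Lemma acyclic_simple_cylinder :
  acy (s (Cyl cop f g)) <->
  acy (s (Cyl cop (fmap (SConst Dt) (fmap s f)) (fmap (SConst Dt) (fmap s g)))).
Proof.
have [p Ip] := mu_at_iso B.
have h1 := acyclic_E diag_comparison_E.
have h2 := acyclic_E level_comparison_E.
have h3 := acyclic_iso Ip.
by rewrite h1 h2.
Qed.

End SimpleCylinder.

(** As [s Z] is acyclic, [Cyl(s f × Δ, s g × Δ)] is degreewise equivalent to the
    cone of [s f × Δ], obtained by collapsing [s Z] to the final object. *)
Lemma simple_E_cylinder (X Y Z : Simp Dt) (f : hom X Y) (g : hom X Z) :
  acy (s Z) -> (E (fmap s f) <-> acy (s (Cyl cop f g))).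
Proof.
move=> aZ; rewrite acyclic_simple_cylinder sd_cone.
pose T := @Fun_terminal (op Delta) Dt (sd_ter D).
have yf : idm _ ∘ fmap (SConst Dt) (fmap s f) ≈ fmap (SConst Dt) (fmap s f) ∘ idm _.
  by rewrite comp1m compm1.
have zg : ter_map T (SConst Dt (s Z)) ∘ fmap (SConst Dt) (fmap s g) ≈
          ter_map T (SConst Dt (s X)) ∘ idm _ by apply: ter_uniq.
have := acyclic_E (@Cyl_map_E _ _ _ _ _ _ _ _ _ _ _ _ _ yf zg
  (fun n => E_id _) (fun n => E_id _) (fun n => aZ)).
by move=> ->.
Qed.

(** Apply [simple_E_cylinder] on both sides of the associativity isomorphism
    [Cyl(J, q) = Cyl(f, I g)], where [q : Z -> 1] and [I : Z -> Cyl(Id, q)]; its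
    hypothesis holds for [s Cyl(Id, q)] by the same lemma applied to [Id]. *)
Lemma Cyl_J_E (X Y Z : Simp Dt) (f : hom X Y) (g : hom X Z) :
  E (fmap s (Cyl_J cop f g)) <-> E (fmap s f).
Proof.
pose T := @Fun_terminal (op Delta) Dt (sd_ter D).
pose q := ter_map T Z.
have aT : acy (s (ter_ob T)).
  apply: E_heq (sd_lambda_E (ter_ob (sd_ter D))); exact: ter_uniq.
have aN : acy (s (Cyl cop (idm Z) q)).
  by apply/simple_E_cylinder => //; apply: E_heq (E_id _); rewrite fmap1.
rewrite (simple_E_cylinder _ q aT).
rewrite (simple_E_cylinder f (Cyl_I cop (idm Z) q ∘ g) aN).
have [h Ih] := univ_cyl_assoc (P := Cyl_univ cop f g)
  (N := Cyl_univ cop (idm Z) q) (Cyl_univ cop (Cyl_J cop f g) q)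
  (Cyl_univ cop f (Cyl_I cop (idm Z) q ∘ g)).
exact: (acyclic_E (E_iso (fmap_iso s Ih))).
Qed.

End CylinderEquivalences.

(** * Cylinders, homotopies and fractions *)

Section Fractions.
Context (D : SimplicialDescentCategory).
Notation Dt := (sd_cat D).
Notation E := (@sd_E D).
Notation cop := (@sd_cop D).
Notation s := (sd_s D).

Lemma s_const_E (A B : Dt) (f : hom A B) :
  E f -> E (fmap s (fmap (SConst Dt) f)).
Proof. by move=> Ef; apply: sd_exact => n. Qed.

Lemma cyl_j_E (A B C : Dt) (f : hom A B) (g : hom A C) :
  E f -> E (cyl_j f g).
Proof.
move=> Ef; apply: E_comp (rho_E C).
by apply/Cyl_J_E; apply: s_const_E.
Qed.

(** In a gluing on [cyl(p, j)], with [j : A -> Ã], the map [p] is an equivalence as a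
    section of one, hence so is the inclusion of [Ã], on which [η] restricts to the
    projection [ν] of [Ã]. *)
Lemma admissible_E (A : Dt) (c : CylTriple A) : admissible c -> E (ct_nu c).
Proof.
elim=> [|{}c _ //|{}c d _ Ec _ Ed]; first exact: E_id.
have Ep : E (ct_i d).
  by apply: E_cancel_l Ed _; apply: E_heq (E_id A); rewrite ct_nui.
apply: E_cancel_r (cyl_j_E (ct_j c) Ep) _.
by apply: E_heq Ec; symmetry; apply: cyl_desc_j.
Qed.

(** The two ends of an admissible cylinder are sections of the same equivalence,
    so they are both its inverse in [Ho D]. *)
Lemma homotopic_Ho (A B : Dt) (f g : hom A B) :
  homotopic f g -> fmap (toLoc E) f ≈ fmap (toLoc E) g.
Proof.
move=> [c [ac [H [<- <-]]]]; rewrite !fmapM.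
have /sd_saturated [n [nl _]] := admissible_E ac.
have e (i : hom A (ct_ob c)) : ct_nu c ∘ i ≈ idm A -> fmap (toLoc E) i ≈ n.
  move=> ei; rewrite -(comp1m (fmap (toLoc E) i)) -nl -compA -fmapM ei fmap1.
  exact: compm1.
by rewrite (e _ (ct_nui c)) (e _ (ct_nuj c)).
Qed.

Lemma KE_E (A B : Dt) (f : @hom Dt A B) : KE f <-> E f.
Proof.
split=> [[e [Ee h]]|Ef]; last by exists f; split=> //; apply: heq_homotopic.
apply/sd_saturated; have /sd_saturated := Ee.
by apply: iso_heq; symmetry; apply: homotopic_Ho.
Qed.

(** The gluing of two trivial cylinders is [cyl(A) = cyl(Id, Id)], which maps to
    [cyl(f, g)]. *)
Lemma cyl_homotopic (A B C : Dt) (f : hom A B) (g : hom A C) :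
  homotopic (cyl_j f g ∘ g) (cyl_i f g ∘ f).
Proof.
exists (ct_glue (ct_id A) (ct_id A)); split.
  by apply: adm_glue; apply: adm_id.
have ef : f ∘ idm A ≈ f ∘ idm A by [].
have eg : g ∘ idm A ≈ g ∘ idm A by [].
exists (cyl_map ef eg); split.
  transitivity (cyl_map ef eg ∘ cyl_j (idm A) (idm A)); last exact: cyl_map_j.
  by apply: comp_heq => //; exact: compm1.
transitivity (cyl_map ef eg ∘ cyl_i (idm A) (idm A)); last exact: cyl_map_i.
by apply: comp_heq => //; exact: compm1.
Qed.

(** Let [H : Ã -> B] be a homotopy from [f e] to [g e] on a cylinder [(i, j, ν)] of
    [A'].  The homotopy pushout [M] of [A ⊔ A <- A' ⊔ A' -> Ã] has maps
    [w : M -> A], equal to the identity on the copies of [A] and to [e ν] on [Ã],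
    and [v : M -> B], equal to [f], [g] on the copies of [A] and to [H] on [Ã].
    As [Ã -> M] and [e ν] are equivalences, so is [w], hence also
    [t : B -> cyl(w, v)]; and [t v] is homotopic to a map that factors through [w],
    which does not distinguish the copies of [A]. *)
Lemma homotopic_left_cancel (A' A B : Dt) (e : hom A' A) (f g : hom A B) :
  E e -> homotopic (f ∘ e) (g ∘ e) ->
  exists (B' : Dt) (t : hom B B'), E t /\ homotopic (t ∘ f) (t ∘ g).
Proof.
move=> Ee [c [ac [H [Hi Hj]]]].
pose S' := bcop cop A' A'; pose S := bcop cop A A.
pose ee := bc_map S' S e e.
pose ij := copair S' (ct_i c) (ct_j c).
have wy : copair S (idm A) (idm A) ∘ ee ≈ idm A ∘ (copair S' e e).
  by apply: bc_uniq; rewrite -!compA comp1m /ee /bc_map ?copair1 ?copair2 compA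
    ?copair1 ?copair2 comp1m.
have wz : e ∘ ct_nu c ∘ ij ≈ idm A ∘ (copair S' e e).
  by apply: bc_uniq; rewrite -!compA comp1m /ij ?copair1 ?copair2
    ?ct_nui ?ct_nuj compm1.
have vy : copair S f g ∘ ee ≈ idm B ∘ (H ∘ ij).
  by apply: bc_uniq; rewrite -!compA comp1m /ee /ij /bc_map ?copair1 ?copair2 compA
    ?copair1 ?copair2 ?Hi ?Hj.
have vz : H ∘ ij ≈ idm B ∘ (H ∘ ij) by rewrite comp1m.
pose w := cyl_desc wy wz; pose v := cyl_desc vy vz.
have Ew : E w.
  apply: E_cancel_r (cyl_j_E ij (sd_E_cop Ee Ee)) _.
  apply: E_heq (E_comp Ee (admissible_E ac)).
  by symmetry; apply: cyl_desc_j.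
exists (cyl w v), (cyl_j w v); split; first exact: cyl_j_E.
have h := cyl_homotopic w v.
(* Both [t f] and [t g] are homotopic to [A -> cyl(w, v)]. *)
have hk (k : hom A (bc_ob S)) (f' : hom A B) :
    copair S (idm A) (idm A) ∘ k ≈ idm A -> copair S f g ∘ k ≈ f' ->
    homotopic (cyl_j w v ∘ f') (cyl_i w v).
  move=> ek ef.
  have hw : cyl_i w v ∘ w ∘ (cyl_i ee ij ∘ k) ≈ cyl_i w v.
    by rewrite -compA (compA w) /w cyl_desc_i ek compm1.
  have hv : cyl_j w v ∘ v ∘ (cyl_i ee ij ∘ k) ≈ cyl_j w v ∘ f'.
    by rewrite -compA (compA v) /v cyl_desc_i ef.
  apply: homotopic_trans (homotopic_trans _ (heq_homotopic hw)).
    by apply: heq_homotopic; symmetry; exact: hv.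
  exact: homotopic_precomp.
apply: homotopic_trans (homotopic_sym _).
  by apply: (hk (in1 S)); rewrite copair1.
by apply: (hk (in2 S)); rewrite copair2.
Qed.

Lemma KE_left_fractions : left_fractions (@KE D).
Proof.
split.
- by move=> A; apply/KE_E; exact: E_id.
- by move=> A B C g f /KE_E Ef /KE_E Eg; apply/KE_E; apply: E_comp.
- move=> A A' B e u /KE_E Ee.
  exists (@cyl D A A' B e u), (cyl_j e u), (cyl_i e u); split.
    by apply/KE_E; apply: cyl_j_E.
  by apply: homotopic_sym; apply: cyl_homotopic.
- move=> A' A B e f g /KE_E Ee h.
  have [B' [t [Et ht]]] := homotopic_left_cancel Ee h.
  by exists B', t; split=> //; apply/KE_E.
Qed.

End Fractions.

(** * Comparison of the localizations *)

Section Comparison.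
Context (D : SimplicialDescentCategory).
Notation Dt := (sd_cat D).
Notation E := (@sd_E D).

Lemma E_KE (A B : Dt) (f : hom A B) : E f -> KE (fmap (toK D) f).
Proof. by move=> Ef; apply/KE_E. Qed.

Definition Ho_to_LocK : Functor (HoCat D) (Loc (@KE D)) :=
  @LocMap Dt (KCat D) E (@KE D) (toK D) E_KE.

(** This cannot come from a functor [K D -> D], as homotopic maps may be distinct in
    [D]; it respects the congruence by [homotopic_Ho]. *)
Fixpoint zig_of_K (A B : Dt) (p : @zig (KCat D) (@KE D) A B) : @zig Dt E A B :=
  match p with
  | zfwd A B f => @zfwd Dt E A B f
  | zinv A B f Ef => @zinv Dt E A B f (iffLR (KE_E f) Ef)
  | zcomp A B C q p => @zcomp Dt E A B C (zig_of_K q) (zig_of_K p)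
  end.

Definition LocK_to_Ho : Functor (Loc (@KE D)) (HoCat D).
Proof.
refine (@MkFunctor (Loc (@KE D)) (HoCat D) (fun A => A) zig_of_K _ _ _).
- move=> A B p q; elim {A B p q} => /=.
  + by move=> *; apply: zeq_refl.
  + by move=> *; apply: zeq_sym.
  + by move=> A B p q r _ e1 _; apply: zeq_trans e1.
  + by move=> *; apply: zeq_cong.
  + by move=> *; apply: zeq_assoc.
  + by move=> *; apply: zeq_1z.
  + by move=> *; apply: zeq_z1.
  + by move=> A B f g; apply: homotopic_Ho.
  + by move=> *; apply: zeq_comp.
  + by move=> *; apply: zeq_invl.
  + by move=> *; apply: zeq_invr.
- by move=> A; apply: zeq_refl.
- by move=> A B C g f; apply: zeq_refl.
Defined.

End Comparison.

Lemma zinv_irrelevant (C : Category) (E : MorClass C) (x y : C) (f : hom x y)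
  (Ef Ef' : E _ _ f) : zeq (zinv Ef) (zinv Ef').
Proof.
apply: zeq_trans (zeq_sym (zeq_z1 _)) _.
apply: zeq_trans (zeq_cong (zeq_refl _) (zeq_sym (zeq_invr Ef'))) _.
apply: zeq_trans (zeq_assoc _ _ _) _.
apply: zeq_trans (zeq_cong (zeq_invl Ef) (zeq_refl _)) _.
exact: zeq_1z.
Qed.

Theorem theorem2p6 (D : SimplicialDescentCategory) :
  (exists F : Functor (HoCat D) (Loc (@KE D)),
     is_cat_iso F /\
     eqF (F ∘F toLoc (@sd_E D)) (toLoc (@KE D) ∘F toK D)) /\
  left_fractions (@KE D).
Proof.
split; last exact: KE_left_fractions.
exists (Ho_to_LocK D); split; last first.
  exists (fun=> erefl) => A B f /=.
  by apply: zeq_trans (zeq_1z _) (zeq_sym (zeq_z1 _)).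
exists (LocK_to_Ho D); split; exists (fun=> erefl) => A B p /=;
    apply: zeq_trans (zeq_1z _) (zeq_trans _ (zeq_sym (zeq_z1 _)));
    elim: p => {A B} [A B f|A B f Ef|A B C q eq p ep] /=.
- exact: zeq_refl.
- exact: zinv_irrelevant.
- exact: zeq_cong.
- exact: zeq_refl.
- exact: zinv_irrelevant.
- exact: zeq_cong.
Qed.
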